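(* Let $F$ be a probability distribution on $[0,\infty)$ with finite mean and finite variance, having a density $f$. Assume that $\frac{f(t)}{t^{\alpha}}\to C$ as $t\to 0+$, where $C>0$ is a constant and $0<\alpha<1$. Let $T_n^{NN}$ be the length of the nearest neighbor tour on $n$ cities in the mean field traveling salesman problem with intercity distance distribution $F$. Set $$K_{\alpha}:=\left(\frac{1+\alpha}{C}\right)^{\frac{1}{1+\alpha}}\frac{1+\alpha}{\alpha}\,\Gamma\!\left(1+\frac{1}{1+\alpha}\right).$$ Then, as $n\to\infty$, $$\frac{T_n^{NN}}{n^{1-\frac{1}{1+\alpha}}}\longrightarrow K_{\alpha}\quad\text{in probability},$$ and $$\mathbb{E}[T_n^{NN}]\sim K_{\alpha}\, n^{1-\frac{1}{1+\alpha}} .$$ Moreover, the convergence $T_n^{NN}/n^{1-\frac{1}{1+\alpha}}\to K_\alpha$ also holds in $\mathcal{L}_2$.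
   Context: Mean field traveling salesman problem: there are $n$ cities $1,2,\dots,n$, and the intercity distances $L_{ij}=L_{ji}$, $1\le i<j\le n$, are i.i.d. random variables with distribution $F$ (no triangle inequality is required). Nearest neighbor (NN) tour: start at $v_1=1$; given $v_1,\dots,v_i$ with $i<n$, let $v_{i+1}$ be the city $u\notin\{v_1,\dots,v_i\}$ minimizing $L_{v_i u}$ (ties broken arbitrarily; they have probability zero when $F$ has a density); after all cities are visited, return to city $1$, i.e. $v_{n+1}=1$. The length of the NN tour is $T_n^{NN}=\sum_{i=1}^{n} L_{v_i v_{i+1}}$. The notation $a_n\sim b_n$ means $\lim_{n\to\infty} a_n/b_n=1$; $\Gamma$ is the Gamma function. *)

(* Defs.v *)
From HB Require Import structures.
From mathcomp Require Import all_boot all_order all_algebra.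
From mathcomp Require Import all_classical all_reals all_analysis.

Set Implicit Arguments.
Unset Strict Implicit.
Unset Printing Implicit Defensive.

Import Order.TTheory GRing.Theory Num.Theory.
Import numFieldNormedType.Exports.

Local Open Scope classical_set_scope.
Local Open Scope ring_scope.

Definition Gamma (R : realType) (s : R) : R :=
  \int[@lebesgue_measure R]_(t in `]0, +oo[) (t `^ (s - 1) * expR (- t)).

Definition is_density (R : realType) (F : probability R R) (f : R -> R) : Prop :=
  [/\ measurable_fun [set: R] f,
      forall t, 0 <= f t &
      forall A : set R, measurable A ->
        F A = (\int[@lebesgue_measure R]_(t in A) (f t)%:E)%E].

(* The subfamily of [X] indexed by [D] is mutually independent. *)
Definition mutually_independent (d : measure_display) (T : measurableType d)
    (R : realType) (P : probability T R) (I : finType) (D : {set I})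
    (X : I -> T -> R) : Prop :=
  forall (J : {set I}) (B : I -> set R),
    J \subset D -> (forall i, measurable (B i)) ->
    P [set w | forall i, i \in J -> B i (X i w)] =
      (\prod_(i in J) P (X i @^-1` B i))%E.

(* Symmetric intercity distances on [m] cities, with the [L i j], [i < j],
   i.i.d. of law [F]; the diagonal entries are left unconstrained. *)
Definition mean_field_distances (d : measure_display) (T : measurableType d)
    (R : realType) (P : probability T R) (F : probability R R) (m : nat)
    (L : 'I_m -> 'I_m -> {RV P >-> R}) : Prop :=
  [/\ forall i j w, L i j w = L j i w,
      forall (i j : 'I_m) (A : set R), (i < j)%N -> measurable A ->
        distribution P (L i j) A = F A &
      mutually_independent P [set ij : 'I_m * 'I_m | (ij.1 < ij.2)%N]%SET
        (fun ij => L ij.1 ij.2 : T -> R)].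

(* A tour of the [n.+1] cities ['I_n.+1] is given by [v 0, ..., v n] followed by
   [v n.+1]; the values of [v] beyond [n.+1] are irrelevant. City [ord0] is the
   starting city. The nearest neighbour rule is a relation, so that any choice
   is allowed in case of ties. *)
Definition visited (n : nat) (v : nat -> 'I_n.+1) (k : nat) : {set 'I_n.+1} :=
  [set v (val j) | j : 'I_k.+1]%SET.

Definition NN_tour (R : realType) (n : nat) (l : 'I_n.+1 -> 'I_n.+1 -> R)
    (v : nat -> 'I_n.+1) : Prop :=
  [/\ v 0%N = ord0,
      forall k, (k < n)%N ->
        v k.+1 \notin visited v k /\
        (forall u, u \notin visited v k -> l (v k) (v k.+1) <= l (v k) u) &
      v n.+1 = ord0].

Definition tour_length (R : realType) (n : nat) (l : 'I_n.+1 -> 'I_n.+1 -> R)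
    (v : nat -> 'I_n.+1) : R :=
  \sum_(k < n.+1) l (v k) (v k.+1).

(* In the next two definitions the [n]-th variable may live on its own
   probability space, the limit being a constant. *)
Definition cvg_in_probability (R : realType) (d : nat -> measure_display)
    (T : forall n, measurableType (d n)) (P : forall n, probability (T n) R)
    (X : forall n, T n -> R) (c : R) : Prop :=
  forall e : R, 0 < e ->
    P n [set w | e <= `|X n w - c|] @[n --> \oo] --> 0%E.

Definition cvg_in_L2 (R : realType) (d : nat -> measure_display)
    (T : forall n, measurableType (d n)) (P : forall n, probability (T n) R)
    (X : forall n, T n -> R) (c : R) : Prop :=
  Lnorm (P n) 2%:E (fun w => (X n w - c)%:E) @[n --> \oo] --> 0%E.

(* [a n ~ b n]; [a] is extended-real so that it can be an expectation. *)
Definition asymptotically_equal (R : realType) (a : nat -> \bar R)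
    (b : nat -> R) : Prop :=
  (a n / (b n)%:E)%E @[n --> \oo] --> 1%E.

Definition NN_constant (R : realType) (C alpha : R) : R :=
  ((1 + alpha) / C) `^ (1 + alpha)^-1 * ((1 + alpha) / alpha) *
  Gamma (1 + (1 + alpha)^-1).

(* Main.v *)
(* Off a null set the distances are nonnegative and have no ties, so the tour is a
   deterministic greedy walk. When [m] cities remain, the current city looks only
   at fresh edges: its step is the minimum of [m] independent variables of law [F],
   independent of the rest of the walk, whose law depends only on the number of
   remaining cities. By induction the mean of the walk is the sum of the means of
   these minima and its variance is at most the sum of their second moments. The
   closing edge was seen at the first step, but its end is uniformly distributed,
   so its second moment is bounded. Writing the moments of a minimum as integrals of
   powers of the tail of [F], and squeezing this tail near [0] between exponentials
   of [t `^ (1 + alpha)], gives the mean [c m `^ (- (1 + alpha)^-1)] and a summable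
   second moment. Summing over [m] yields convergence in L2, hence the other two
   modes. *)
Require Import Defs.
From HB Require Import structures.
From mathcomp Require Import all_boot all_order all_algebra.
From mathcomp Require Import all_classical all_reals all_analysis.
From mathcomp Require Import measurable_realfun.
From mathcomp Require Import ring lra.

Set Implicit Arguments.
Unset Strict Implicit.
Unset Printing Implicit Defensive.

Import Order.TTheory GRing.Theory Num.Theory.
Import numFieldNormedType.Exports.

Local Open Scope classical_set_scope.
Local Open Scope ring_scope.

(** * The nearest neighbour tour as a greedy walk *)

Section greedy_walk.
Variables (R : realType) (n : nat).
Implicit Types (l g : 'I_n.+1 -> 'I_n.+1 -> R) (phi : 'I_n.+1 -> R)
  (U : {set 'I_n.+1}) (v : nat -> 'I_n.+1).

(** The choice of the next city is random, and no measurability of the tour [v] is given, so nothing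
    is conditioned on its past. [greedy_walk] sums over all candidate next cities with indicator
    weights: it is an explicit measurable function of the distances and agrees with the tour
    whenever there are no ties. For a fixed candidate, the step and the rest of the walk live on two
    deterministic disjoint blocks of edges, so plain independence replaces conditioning, and
    inductions on the number of remaining cities close because the moments depend on that number
    alone. All quantities are nonnegative, so expectations are extended reals and linearity needs no
    integrability. Origin of the limit: with [g = 1 + alpha], [b = 1 / g] and [c = C / g], the tail
    of [F] near [0] behaves like [exp (- c t^g)], so the minimum of [m] variables has mean close to
    [(m c)^(-b) Gamma (1 + b)]. Summing [m^(-b)] brings the factor
    [1 / (1 - b) = (1 + alpha) / alpha]. The sum of the second moments only has to be of smaller
    order than the squared normalization. *)

Definition strict_argmin l x U u : bool :=
  [forall u' in (U :\ u)%SET, l x u < l x u'].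

(* Ties are not broken: if no city of [U] is the strict minimizer the sum is
   empty. This is harmless because ties have probability zero. *)
Fixpoint greedy_walk l g phi (m : nat) x U : R :=
  if m is m'.+1 then
    \sum_(u in U) (strict_argmin l x U u)%:R *
                  (g x u + greedy_walk l g phi m' u (U :\ u)%SET)
  else phi x.

(** The walk never compares edges without a common end, nor reads the diagonal, so only ties at a
    common city are excluded. *)
Definition tie_free l := forall x u u', x != u -> x != u' -> u != u' -> l x u != l x u'.

Lemma strict_argmin_uniq l x U u u' : u \in U -> u' \in U ->
  strict_argmin l x U u -> strict_argmin l x U u' -> u = u'.
Proof.
move=> uU u'U /forall_inP hu /forall_inP hu'; apply/eqP/negP => /negP uu'.
have h1 := hu u'; have h2 := hu' u.
have : l x u < l x u' by apply: h1; rewrite !inE eq_sym uu'.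
by rewrite ltNge ltW// h2// !inE uu'.
Qed.

Lemma sum_strict_argmin l x U (h : 'I_n.+1 -> R) u : u \in U ->
  strict_argmin l x U u ->
  \sum_(i in U) (strict_argmin l x U i)%:R * h i = h u.
Proof.
move=> uU su; rewrite (bigD1 u)//= su mul1r big1 ?addr0// => i /andP[iU iu].
case: (boolP (strict_argmin _ _ _ _)) => [si|]; last by rewrite mul0r.
by rewrite (strict_argmin_uniq iU uU si su) eqxx in iu.
Qed.

(** At most one term of the sum is nonzero, so squaring creates no cross terms. *)
Lemma sqr_sum_strict_argmin l x U (h : 'I_n.+1 -> R) :
  (\sum_(u in U) (strict_argmin l x U u)%:R * h u) ^+ 2 =
  \sum_(u in U) (strict_argmin l x U u)%:R * h u ^+ 2.
Proof.
have [/exists_inP[u uU su]|/exists_inPn sN] :=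
    boolP [exists u in U, strict_argmin l x U u].
  by rewrite !(sum_strict_argmin _ uU su).
by rewrite !big1 ?expr0n//= => u /sN/negbTE ->; rewrite mul0r.
Qed.

(** A walk that makes a step ends inside [U]. With no step it stays at [x], which may be [j]; hence
    [m.+1]. *)
Lemma greedy_walk_off l j m x U : j \notin U ->
  greedy_walk l (fun _ _ => 0) (fun i => (i == j)%:R) m.+1 x U = 0.
Proof.
elim: m x U => [|m IHm] x U jU; rewrite [LHS]/= big1// => u uU.
  by case: eqP => [uj|]; [rewrite uj (negbTE jU) in uU|rewrite addr0 mulr0].
by rewrite [X in _ + X]IHm ?addr0 ?mulr0// !inE negb_and jU orbT.
Qed.

Lemma tie_free_strict_argmin l x U u : tie_free l -> x \notin U -> u \in U ->
  (forall u', u' \in U -> l x u <= l x u') -> strict_argmin l x U u.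
Proof.
move=> lT xU uU umin; apply/forall_inP => u'; rewrite !inE => /andP[u'u u'U].
rewrite lt_neqAle umin// andbT; apply: lT; last by rewrite eq_sym.
  by apply: contraNneq xU => ->.
by apply: contraNneq xU => ->.
Qed.

Lemma ex_strict_argmin l x U : tie_free l -> x \notin U -> (0 < #|U|)%N ->
  exists2 u, u \in U & strict_argmin l x U u.
Proof.
move=> lT xU /card_gt0P[u0 u0U].
case: (@Order.TotalTheory.arg_minP _ _ _ u0 (mem U) (l x) u0U) => u uU umin.
by exists u => //; exact: tie_free_strict_argmin.
Qed.

Section along_tour.
Variables (l : 'I_n.+1 -> 'I_n.+1 -> R) (v : nat -> 'I_n.+1).
Hypotheses (lT : tie_free l) (vNN : NN_tour l v).

Let unvisited k : {set 'I_n.+1} := (~: visited v k)%SET.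

Lemma unvisitedS k : unvisited k.+1 = (unvisited k :\ v k.+1)%SET.
Proof.
rewrite /unvisited; apply/setP => i; rewrite !inE -negb_or; congr (~~ _).
apply/imsetP/orP => [[j _ ->]|].
  have := ltn_ord j; rewrite ltnS leq_eqVlt => /orP[/eqP jk|jk].
    by left; apply/eqP; congr (v _).
  by right; apply/imsetP; exists (Ordinal jk).
move=> [/eqP ->|/imsetP[j _ ->]]; first by exists ord_max.
by exists (widen_ord (leqnSn _) j).
Qed.

Lemma unvisited0 : unvisited 0 = (~: [set ord0])%SET.
Proof.
have [v0 _ _] := vNN; congr (~: _)%SET; apply/setP => i; rewrite !inE.
apply/imsetP/eqP => [[j _ ->]|->]; first by rewrite (ord1 j).
by exists ord0.
Qed.

Lemma NN_tour_strict_argmin k : (k < n)%N ->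
  v k.+1 \in unvisited k /\ strict_argmin l (v k) (unvisited k) (v k.+1).
Proof.
move=> kn; have [_ /(_ k kn)[vk vmin] _] := vNN.
have vU : v k.+1 \in unvisited k by rewrite inE.
split=> //; apply: tie_free_strict_argmin => //.
  by rewrite !inE negbK; apply/imsetP; exists ord_max.
by move=> u'; rewrite inE => /vmin.
Qed.

(** Each sum over candidates collapses to the city chosen by the tour. The cost [g] and the final
    payment [phi] are free, so that one identity serves both the length and the indicator of the
    last city. *)
Lemma greedy_walk_tour g phi k m : (k + m = n)%N ->
  greedy_walk l g phi m (v k) (unvisited k) =
  \sum_(k <= i < n) g (v i) (v i.+1) + phi (v n).
Proof.
elim: m k => [|m IHm] k.
  by rewrite addn0 => -> /=; rewrite big_geq ?add0r.
move=> kmn; have kn : (k < n)%N by rewrite -kmn addnS ltnS leq_addr.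
have [vU vs] := NN_tour_strict_argmin kn.
rewrite /= (sum_strict_argmin _ vU vs) -unvisitedS IHm; last by rewrite addSnnS.
by rewrite [in RHS]big_ltn// addrA.
Qed.

Lemma NN_tour_last_unvisited k : (k < n)%N -> v n \in unvisited k.
Proof.
have h j : (k + j.+1 <= n)%N -> v (k + j.+1)%N \in unvisited k.
  elim: j k => [|j IHj] k kj.
    by rewrite addn1; apply: (NN_tour_strict_argmin _).1; rewrite -addn1.
  have : v (k.+1 + j.+1)%N \in unvisited k.+1 by apply: IHj; rewrite addSnnS.
  by rewrite unvisitedS inE addSnnS => /andP[].
move=> kn; have := h (n - k.+1)%N; rewrite addnS -addSn subnKC//; exact.
Qed.

Lemma tour_length_greedy_walk :
  tour_length l v = greedy_walk l l (fun _ => 0) n ord0 (~: [set ord0])%SET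
                    + l (v n) ord0.
Proof.
have [v0 _ vn] := vNN.
rewrite -{1}unvisited0 -{1}v0 greedy_walk_tour ?add0n// addr0.
by rewrite /tour_length big_ord_recr/= vn big_mkord.
Qed.

(** Split by the first city [u] and the last city [j]: the first two factors depend only on edges at
    [ord0], the third only on the other edges. As [n] exceeds [1], the last city differs from the
    first one chosen. *)
Lemma last_edge_sqr : (1 < n)%N -> (l (v n) ord0) ^+ 2 =
  \sum_(u in ~: [set ord0]) \sum_(j in ~: [set ord0] :\ u)
    (strict_argmin l ord0 (~: [set ord0]) u)%:R * (l j ord0) ^+ 2 *
    greedy_walk l (fun _ _ => 0) (fun i => (i == j)%:R) n.-1 u
      (~: [set ord0] :\ u)%SET.
Proof.
move=> n1; have [v0 _ _] := vNN; have n0 : (0 < n)%N by exact: ltn_trans n1.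
have [vU vs] := NN_tour_strict_argmin n0; rewrite v0 unvisited0 in vU vs.
under eq_bigr => u _ do under eq_bigr => j _ do rewrite -mulrA.
under eq_bigr => u _ do rewrite -mulr_sumr.
rewrite (sum_strict_argmin _ vU vs) -unvisited0 -unvisitedS.
under eq_bigr => j _ do rewrite greedy_walk_tour ?add1n ?prednK// big1// add0r.
rewrite (bigD1 (v n)) ?NN_tour_last_unvisited//= eqxx mulr1 big1 ?addr0// => j.
by case/andP => _; rewrite eq_sym => /negbTE ->; rewrite mulr0.
Qed.

End along_tour.
End greedy_walk.

(** * Independence of disjoint blocks of variables *)

Section independence.
Local Open Scope ereal_scope.
Context d (T : measurableType d) (R : realType) (P : probability T R).

Definition independent_events (A B : set T) := P (A `&` B) = P A * P B.

Lemma lambda_system_independent (B : set T) : measurable B ->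
  lambda_system [set: T] [set A | measurable A /\ independent_events A B].
Proof.
move=> mB; split=> //.
- by split; [exact: measurableT|rewrite /independent_events setTI probability_setT mul1e].
- move=> A1 A2 A21 [mA1 iA1] [mA2 iA2]; split; first exact: measurableD.
  rewrite /independent_events.
  have -> : (A1 `\` A2) `&` B = (A1 `&` B) `\` (A2 `&` B).
    by apply/seteqP; split=> w /=; tauto.
  rewrite measureD; [|exact: measurableI|exact: measurableI|]; last first.
    by rewrite -ge0_fin_numE// fin_num_measure//; exact: measurableI.
  rewrite setIACA setIid (_ : A1 `&` A2 = A2)  ; last exact/setIidr.
  rewrite measureD// ?(setIidr A21)//; last first.
    by rewrite -ge0_fin_numE// fin_num_measure.
  transitivity (P (A1 `&` B) - P (A2 `&` B)); first by [].
  rewrite iA1 iA2 -muleBl ?fin_num_measure//.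
  by rewrite fin_num_adde_defl// fin_numN fin_num_measure.
- move=> A ndA iA; have mA n : measurable (A n) := (iA n).1.
  have mUA : measurable (\bigcup_n A n) by exact: bigcup_measurable.
  split=> //; rewrite /independent_events setI_bigcupl.
  have c1 : P (A n `&` B) @[n --> \oo] --> P (\bigcup_n (A n `&` B)).
    apply: nondecreasing_cvg_mu => //.
    + by move=> n; exact: measurableI.
    + by apply: bigcup_measurable => n _; exact: measurableI.
    + by move=> m n mn; apply/subsetPset; apply: setSI; apply/subsetPset; exact: ndA.
  have c2 : P (A n) * P B @[n --> \oo] --> P (\bigcup_n A n) * P B.
    apply: cvgeZr; first by rewrite fin_num_measure.
    exact: nondecreasing_cvg_mu.
  apply: cvg_unique c1 _ => //.
  rewrite /= (_ : (fun n => P (A n `&` B)) = fun n => P (A n) * P B)//.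
  by apply/funext => n; exact: (iA n).2.
Qed.

(** Two passes of the pi-lambda argument: [A] ranges over the first sigma-algebra while [B] stays in
    [G2], then [B] is extended in turn. *)
Lemma independent_sigma (G1 G2 : set (set T)) :
  setI_closed G1 -> setI_closed G2 ->
  G1 `<=` measurable -> G2 `<=` measurable ->
  (forall A B, G1 A -> G2 B -> independent_events A B) ->
  forall A B, <<s G1 >> A -> <<s G2 >> B -> independent_events A B.
Proof.
move=> I1 I2 m1 m2 ind A B sA sB.
have mA : measurable A.
  by apply: smallest_sub sA => //; exact: sigma_algebra_measurable.
have h : <<s G1 >> `<=` [set A | measurable A /\ forall B, G2 B -> independent_events A B].
  move=> A' sA'; split.
    by apply: smallest_sub sA' => //; exact: sigma_algebra_measurable.
  move=> B' GB'.
  have := lambda_system_subset I1 (lambda_system_independent (m2 _ GB')).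
  by move=> /(_ _ _ A')[]// X GX; split; [exact: m1|exact: ind].
have : <<s G2 >> `<=` [set B | measurable B /\ independent_events B A].
  apply: (lambda_system_subset I2 (lambda_system_independent mA)) => //.
  move=> X GX; split; first exact: m2.
  by rewrite /independent_events setIC muleC; apply: (h _ sA).2.
by move=> /(_ _ sB)[_]; rewrite /independent_events setIC muleC.
Qed.

Definition independent_functions (Y Z : T -> R) := forall A B : set R,
  measurable A -> measurable B -> independent_events (Y @^-1` A) (Z @^-1` B).

Section functions.
Variables Y Z : {RV P >-> R}.
Hypothesis YZ : independent_functions Y Z.

Lemma measurable_pair_RV : measurable_fun [set: T] (fun w => (Y w, Z w)).
Proof. exact: measurable_fun_pair. Qed.

Let YZm : {mfun T >-> (R * R)%type} :=
  HB.pack (fun w => (Y w, Z w)) (isMeasurableFun.Build _ _ _ _ _ measurable_pair_RV).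

Lemma joint_distribution_independent (A : set (R * R)) : measurable A ->
  distribution P YZm A = (distribution P Y \x distribution P Z) A.
Proof.
move=> mA; by apply/esym/product_measure_unique => // A1 A2 mA1 mA2; exact: YZ.
Qed.

Lemma ge0_integral_independent (f : (R * R)%type -> \bar R) :
  measurable_fun setT f -> (forall z, 0 <= f z) ->
  \int[P]_w (f (Y w, Z w)) =
  \int[distribution P Y]_y \int[distribution P Z]_z f (y, z).
Proof.
move=> mf f0.
rewrite -[LHS](@ge0_integral_distribution _ _ _ _ _ P YZm)//.
rewrite -(@fubini_tonelli1 _ _ _ _ _ (distribution P Y) (distribution P Z))//.
by apply: eq_measure_integral => A mA _; exact: joint_distribution_independent.
Qed.

Lemma ge0_integral_independentM : (forall w, 0 <= Y w)%R -> (forall w, 0 <= Z w)%R ->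
  \int[P]_w (Y w * Z w)%:E = \int[P]_w (Y w)%:E * \int[P]_w (Z w)%:E.
Proof.
move=> Y0 Z0.
have mN : measurable_fun [set: R] (fun y : R => `|y|%:E).
  by apply/measurable_EFinP; exact: normr_measurable.
have IE (X : {RV P >-> R}) : (forall w, 0 <= X w)%R ->
    \int[distribution P X]_y `|y|%:E = \int[P]_w (X w)%:E.
  move=> X0; rewrite ge0_integral_distribution//.
  by apply: eq_integral => w _ /=; rewrite ger0_norm.
(* Absolute values make the integrand nonnegative on the whole plane without changing it on the
   values of [(Y, Z)]. *)
pose f (z : (R * R)%type) : \bar R := (`|z.1| * `|z.2|)%:E.
transitivity (\int[P]_w f (Y w, Z w)).
  by apply: eq_integral => w _; rewrite /f/= !ger0_norm.
rewrite ge0_integral_independent; last 2 first.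
- apply/measurable_EFinP; apply: measurable_funM; apply: measurableT_comp => //.
- by move=> z; rewrite lee_fin mulr_ge0.
under eq_integral => y _ do under eq_integral => z _ do rewrite /f/= EFinM.
under eq_integral => y _.
  rewrite ge0_integralZl//.
  over.
rewrite ge0_integralZr//=; last by apply: integral_ge0 => z _; rewrite lee_fin.
by rewrite !IE.
Qed.

Lemma measure_lt_independent : P [set w | (Y w < Z w)%R] =
  \int[distribution P Y]_y P (Z @^-1` `]y, +oo[).
Proof.
pose A := [set z : (R * R)%type | (z.1 < z.2)%R].
have mA : measurable A.
  have : measurable_fun setT (fun z : (R * R)%type => (z.1 < z.2)%R).
    exact: measurable_fun_ltr.
  by move=> /(_ measurableT [set true]); rewrite setTI; exact.
transitivity (distribution P YZm A); first by [].
rewrite joint_distribution_independent//.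
apply: eq_integral => y _; congr (P (_ @^-1` _)); apply/seteqP.
by split=> z; rewrite /xsection/= inE/= in_itv/= andbT.
Qed.

(** The sections of the diagonal are single points, null for the law of [Z]. *)
Lemma measure_eq_independent : (forall z, P (Z @^-1` [set z]) = 0) ->
  P [set w | Y w = Z w] = 0.
Proof.
move=> Zna; pose A := [set z : (R * R)%type | z.1 = z.2].
have mA : measurable A.
  have : measurable_fun setT (fun z : (R * R)%type => z.1 == z.2).
    exact: measurable_fun_eqr.
  move=> /(_ measurableT [set true]); rewrite setTI.
  rewrite (_ : _ @^-1` _ = A); first exact.
  by apply/seteqP; split=> z /=; rewrite /A/= => /eqP.
transitivity (distribution P YZm A); first by [].
rewrite joint_distribution_independent//.
apply: integral0_eq => y _; rewrite -[RHS](Zna y); congr (P (_ @^-1` _)).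
by apply/seteqP; split=> z; rewrite /xsection/= inE/= /A/= => ->.
Qed.
End functions.
End independence.

(** * Sigma-algebras generated by blocks of coordinates *)

Section cylinders.
Local Open Scope ereal_scope.
Context d (T : measurableType d) (R : realType) (P : probability T R).
Variables (I : finType) (X : I -> T -> R).
Hypothesis mX : forall i, measurable_fun [set: T] (X i).
Implicit Types D : {set I}.

(** A pi-system generating the sigma-algebra of the [X i] with [i] in [D]. *)
Definition cylinders D : set (set T) :=
  [set A | exists2 B : I -> set R, (forall i, measurable (B i)) &
     A = [set w | forall i, i \in D -> B i (X i w)]].

Lemma cylinders_setI D : setI_closed (cylinders D).
Proof.
move=> _ _ [B1 mB1 ->] [B2 mB2 ->]; exists (fun i => B1 i `&` B2 i).
  by move=> i; exact: measurableI.
apply/seteqP; split=> w /=; first by move=> [h1 h2] i iD; split; auto.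
by move=> h; split=> i /h[].
Qed.

Lemma measurable_cylinders D : cylinders D `<=` measurable.
Proof.
move=> _ [B mB ->].
rewrite (_ : [set w | _] = \bigcap_(i in [set` D]) (X i @^-1` B i)).
  apply: fin_bigcap_measurable => [|i _]; first exact: finite_finset.
  by rewrite -[_ @^-1` _]setTI; exact: mX.
by apply/seteqP; split=> w /=.
Qed.

Lemma cylinders_measurable_fun D i : i \in D ->
  measurable_fun [set: g_sigma_algebraType (cylinders D)]
    (X i : g_sigma_algebraType (cylinders D) -> R).
Proof.
move=> iD _ A mA; rewrite setTI; apply: sub_sigma_algebra.
exists (fun j => if j == i then A else setT).
  by move=> j; case: ifP => // _; exact: measurableT.
apply/seteqP; split=> w /=; last by move=> /(_ i iD); rewrite eqxx.
by move=> Aw j _; case: ifP => // /eqP ->.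
Qed.

Section two_blocks.
Variables D D1 D2 : {set I}.
Hypotheses (D1D : D1 \subset D) (D2D : D2 \subset D)
  (D12 : forall i, i \in D1 -> i \notin D2).
Hypothesis iX : mutually_independent P D X.

Lemma measure_cylinder (J : {set I}) (B : I -> set R) : J \subset D ->
  (forall i, measurable (B i)) ->
  P [set w | forall i, i \in J -> B i (X i w)] = \prod_(i in J) P (X i @^-1` B i).
Proof. by move=> JD mB; exact: iX. Qed.

(** The two cylinders are glued into one over [D1 :|: D2]; the product given by mutual independence
    splits because the blocks are disjoint. *)
Lemma independent_cylinders A1 A2 : cylinders D1 A1 -> cylinders D2 A2 ->
  independent_events P A1 A2.
Proof.
move=> [B1 mB1 ->] [B2 mB2 ->].
pose B i := if i \in D1 then B1 i else B2 i.
have mB i : measurable (B i) by rewrite /B; case: ifP.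
have h2 i : i \in D2 -> (i \in D1) = false.
  by move=> iD2; apply/negP => /D12; rewrite iD2.
have e1 : [set w | forall i, i \in D1 -> B1 i (X i w)] =
    [set w | forall i, i \in D1 -> B i (X i w)].
  by apply/seteqP; split=> w /= h i iD; have := h i iD; rewrite /B iD.
have e2 : [set w | forall i, i \in D2 -> B2 i (X i w)] =
    [set w | forall i, i \in D2 -> B i (X i w)].
  by apply/seteqP; split=> w /= h i iD; have := h i iD; rewrite /B (h2 _ iD).
rewrite /independent_events e1 e2 !measure_cylinder//.
transitivity (\prod_(i in (D1 :|: D2)%SET) P (X i @^-1` B i)).
  rewrite -measure_cylinder//; last by rewrite finset.subUset D1D.
  congr (P _); apply/seteqP; split=> w /=.
    by move=> [h1 h2'] i; rewrite inE => /orP[/h1|/h2'].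
  by move=> h; split=> i iD; apply: h; rewrite inE iD ?orbT.
rewrite (bigID (mem D1))/=; congr (_ * _); apply: eq_bigl => i; rewrite !inE.
  by case: (boolP (i \in D1)); rewrite /= ?andbF.
case: (boolP (i \in D1)) => /= [/D12/negbTE ->|]; first by [].
by rewrite andbT.
Qed.

Lemma independent_blocks (Y Z : T -> R) :
  measurable_fun [set: g_sigma_algebraType (cylinders D1)]
    (Y : g_sigma_algebraType (cylinders D1) -> R) ->
  measurable_fun [set: g_sigma_algebraType (cylinders D2)]
    (Z : g_sigma_algebraType (cylinders D2) -> R) ->
  independent_functions P Y Z.
Proof.
move=> mY mZ A B mA mB.
apply: (independent_sigma (@cylinders_setI D1) (@cylinders_setI D2)).
- exact: measurable_cylinders.
- exact: measurable_cylinders.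
- exact: independent_cylinders.
- by have := mY measurableT A mA; rewrite setTI.
- by have := mZ measurableT B mB; rewrite setTI.
Qed.

Lemma measurable_fun_block D' (Y : T -> R) :
  measurable_fun [set: g_sigma_algebraType (cylinders D')]
    (Y : g_sigma_algebraType (cylinders D') -> R) ->
  measurable_fun [set: T] Y.
Proof.
move=> mY _ A mA; have := mY measurableT A mA; rewrite !setTI => h.
apply: smallest_sub h; first exact: sigma_algebra_measurable.
exact: measurable_cylinders.
Qed.
End two_blocks.
End cylinders.

(** * Nonnegative measurable functions and their expectations *)

Section nonneg_measurable.
Local Open Scope ereal_scope.
Context d (T : measurableType d) (R : realType).

(** The operation is arbitrary and the initial value may vary with [w], which covers sums, products
    and minima started at one of their terms. *)
Lemma measurable_big (op : R -> R -> R) (I : Type) (s : seq I) (p : pred I)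
    (x0 : T -> R) (h : I -> T -> R) :
  (forall f g : T -> R, measurable_fun setT f -> measurable_fun setT g ->
    measurable_fun setT (fun w => op (f w) (g w))) ->
  measurable_fun setT x0 -> (forall i, p i -> measurable_fun setT (h i)) ->
  measurable_fun setT (fun w => \big[op/x0 w]_(i <- s | p i) h i w).
Proof.
move=> opm mx0 mh; elim: s => [|i s IHs].
  by under eq_fun do rewrite big_nil.
under eq_fun do rewrite big_cons; case: (boolP (p i)) => // pi.
by apply: opm => //; exact: mh.
Qed.

Lemma measurable_fun_ltr_nat (f g : T -> R) :
  measurable_fun setT f -> measurable_fun setT g ->
  measurable_fun setT (fun w => (f w < g w)%R%:R : R).
Proof.
move=> mf mg; have mb : measurable_fun setT (fun b : bool => b%:R : R) by [].
by apply: (measurableT_comp mb); exact: measurable_fun_ltr.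
Qed.

Definition nonneg_mfun (f : T -> R) :=
  measurable_fun setT f /\ forall w, (0 <= f w)%R.

Lemma nonneg_mfunD f g : nonneg_mfun f -> nonneg_mfun g ->
  nonneg_mfun (fun w => f w + g w)%R.
Proof.
move=> [mf f0] [mg g0]; split; first exact: measurable_funD.
by move=> w; rewrite addr_ge0.
Qed.

Lemma nonneg_mfunM f g : nonneg_mfun f -> nonneg_mfun g ->
  nonneg_mfun (fun w => f w * g w)%R.
Proof.
move=> [mf f0] [mg g0]; split; first exact: measurable_funM.
by move=> w; rewrite mulr_ge0.
Qed.

Lemma nonneg_mfunX f k : nonneg_mfun f -> nonneg_mfun (fun w => f w ^+ k)%R.
Proof.
move=> [mf f0]; split; first exact: measurable_funX.
by move=> w; rewrite exprn_ge0.
Qed.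

Lemma nonneg_mfun_cst (r : R) : (0 <= r)%R -> nonneg_mfun (fun=> r).
Proof. by split. Qed.

Lemma nonneg_mfun_sum (I : Type) (s : seq I) (p : pred I) (h : I -> T -> R) :
  (forall i, p i -> nonneg_mfun (h i)) ->
  nonneg_mfun (fun w => \sum_(i <- s | p i) h i w)%R.
Proof.
move=> nh; split; last by move=> w; apply: sumr_ge0 => i /nh[].
apply: measurable_big => //; last by move=> i /nh[].
by move=> f g; exact: measurable_funD.
Qed.

Variable P : probability T R.
Local Notation Ex f := (\int[P]_w (f w)%:E).

Lemma ExD f g : nonneg_mfun f -> nonneg_mfun g ->
  Ex (fun w => f w + g w)%R = Ex f + Ex g.
Proof.
move=> [mf f0] [mg g0]; under eq_integral do rewrite EFinD.
rewrite ge0_integralD//; try (by move=> w _; rewrite lee_fin); exact/measurable_EFinP.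
Qed.

Lemma ExZl (k : R) f : (0 <= k)%R -> nonneg_mfun f ->
  Ex (fun w => k * f w)%R = k%:E * Ex f.
Proof.
move=> k0 [mf f0]; under eq_integral do rewrite EFinM.
rewrite ge0_integralZl//; try (by move=> w _; rewrite lee_fin); exact/measurable_EFinP.
Qed.

Lemma Ex_ge0 f : nonneg_mfun f -> 0 <= Ex f.
Proof. by move=> [_ f0]; apply: integral_ge0 => w _; rewrite lee_fin. Qed.

Lemma Ex_sum (I : Type) (s : seq I) (p : pred I) (h : I -> T -> R) :
  (forall i, p i -> nonneg_mfun (h i)) ->
  Ex (fun w => \sum_(i <- s | p i) h i w)%R = \sum_(i <- s | p i) Ex (h i).
Proof.
move=> nh; elim: s => [|i s IHs].
  by under eq_integral do rewrite big_nil; rewrite integral0 big_nil.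
under eq_integral do rewrite big_cons; rewrite big_cons.
case: (boolP (p i)) => // pi.
rewrite ExD ?IHs//; first exact: nh.
exact: nonneg_mfun_sum.
Qed.

Lemma le_Ex f g : nonneg_mfun f -> nonneg_mfun g -> (forall w, f w <= g w)%R ->
  Ex f <= Ex g.
Proof.
move=> [mf f0] [mg g0] fg; apply: ge0_le_integral => //;
  try (by move=> w _; rewrite lee_fin); exact/measurable_EFinP.
Qed.

Lemma ae_eq_Ex f g : nonneg_mfun f -> nonneg_mfun g ->
  {ae P, forall w, f w = g w} -> Ex f = Ex g.
Proof.
move=> [mf f0] [mg g0] fg; apply: ge0_ae_eq_integral => //;
  try (by move=> w _; rewrite lee_fin); try exact/measurable_EFinP.
by apply: filterS fg => w -> _.
Qed.

Lemma Ex_bool (b : T -> bool) : measurable [set w | b w] ->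
  Ex (fun w => (b w)%:R) = P [set w | b w].
Proof.
move=> mb; rewrite -[in RHS](setIT [set w | b w]) -integral_indic//.
by apply: eq_integral => w _; rewrite indicE/=; case: (boolP (b w)) => bw;
  [rewrite mem_set|rewrite memNset//; exact/negP].
Qed.

End nonneg_measurable.

Section greedy_walk_measurable.
Context d (T : measurableType d) (R : realType) (n : nat).
Local Notation I := 'I_n.+1.
Variables (l : I -> I -> T -> R).

(** The indicator is the product of the indicators of the comparisons. The measurable structure on
    [T] is free, so the lemma also applies to the sigma-algebra of a star. *)
Lemma strict_argmin_measurable x (U : {set I}) u :
  (forall u', u' \in U -> measurable_fun setT (l x u')) -> u \in U ->
  measurable_fun setT
    (fun w => (strict_argmin (fun i j => l i j w) x U u)%:R : R).
Proof.
move=> ml uU; rewrite (_ : (fun w => _) =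
    (fun w => \prod_(u' in (U :\ u)%SET) (l x u w < l x u' w)%R%:R) :> (T -> R)).
  apply: measurable_big => //; first by move=> f g; exact: measurable_funM.
  move=> u'; rewrite !inE => /andP[_ u'U].
  by apply: measurable_fun_ltr_nat; exact: ml.
apply/funext => w; rewrite /strict_argmin.
case: (boolP [forall _ in _, _]) => [/forall_inP h|].
  by rewrite big1// => u' /h ->.
rewrite negb_forall_in => /exists_inP[u' u'U /negbTE h].
by rewrite (bigD1 u')//= h mul0r.
Qed.

(** [V] holds the cities whose mutual edges may be read. Taking all cities gives measurability on
    the full space; taking the current set shows that the rest of the walk depends on inner edges
    only. *)
Lemma greedy_walk_nonneg (g : I -> I -> T -> R) (phi : I -> R) (V : {set I}) :
  (forall i j, i \in V -> j \in V -> i != j -> measurable_fun setT (l i j)) ->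
  (forall i j, i \in V -> j \in V -> i != j -> nonneg_mfun (g i j)) ->
  (forall i, 0 <= phi i) ->
  forall m x (U : {set I}), x \in V -> U \subset V -> x \notin U ->
  nonneg_mfun
    (fun w => greedy_walk (fun i j => l i j w) (fun i j => g i j w) phi m x U).
Proof.
move=> ml ng phi0; elim=> [|m IHm] x U xV UV xU /=.
  exact: nonneg_mfun_cst.
have xu u : u \in U -> x != u by move=> uU; apply: contraNneq xU => ->.
have inV u : u \in U -> u \in V by move=> uU; exact: (fintype.subsetP UV).
apply: nonneg_mfun_sum => u uU; apply: nonneg_mfunM.
  split=> //; apply: strict_argmin_measurable => // u' u'U.
  by apply: ml => //; [exact: inV|exact: xu].
apply: nonneg_mfunD; first by apply: ng => //; [exact: inV|exact: xu].
apply: IHm; first exact: inV.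
  by apply: fintype.subset_trans UV; rewrite subD1set.
by rewrite !inE eqxx.
Qed.

End greedy_walk_measurable.

(** * Moments of the walk in the mean field model *)

Section mean_field.
Local Open Scope ereal_scope.
Context d (T : measurableType d) (R : realType) (P : probability T R) (n : nat).
Local Notation I := 'I_n.+1.
Variables (F : probability R R) (l : I -> I -> T -> R).
Hypotheses (ml : forall i j, measurable_fun setT (l i j))
  (l_ge0 : forall i j w, (0 <= l i j w)%R)
  (lC : forall i j w, l i j w = l j i w)
  (lF : forall (i j : I) (A : set R), (i < j)%N -> measurable A ->
    P (l i j @^-1` A) = F A)
  (l_indep : mutually_independent P [set ij : I * I | (ij.1 < ij.2)%N]%SET
    (fun ij => l ij.1 ij.2))
  (F_atomless : forall x, F [set x] = 0).
Implicit Types (x u i j : I) (U V : {set I}).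
Local Notation Ex f := (\int[P]_w (f w)%:E).

Let edges : {set I * I} := [set ij : I * I | (ij.1 < ij.2)%N]%SET.
Let X (ij : I * I) := l ij.1 ij.2.
Let edge i j : I * I := if (i < j)%N then (i, j) else (j, i).
(* [star x U]: the edges compared by a step of the walk from [x];
   [inner U]: the edges that the rest of the walk will look at. They are disjoint
   when [x] is not in [U], whence the independence of a step and its future. *)
Let star x U : {set I * I} := [set edge x u | u in U]%SET.
Let inner U : {set I * I} :=
  [set ij in edges | (ij.1 \in U) && (ij.2 \in U)]%SET.

Let lE i j : l i j = X (edge i j).
Proof. by apply/funext => w; rewrite /X /edge; case: ifP => //= _; rewrite lC. Qed.

Let edge_inj x : injective (edge x).
Proof.
move=> u u'; rewrite /edge; case: (ltnP x u) => h1; case: (ltnP x u') => h2 [] //.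
- by move=> <- ->.
- by move=> -> ->.
Qed.

Let edge_edges i j : i != j -> edge i j \in edges.
Proof.
move=> ij; rewrite inE /edge; case: (ltnP i j) => //= ji.
by rewrite ltn_neqAle ji andbT eq_sym (inj_eq val_inj).
Qed.

Lemma lF_sym i j (A : set R) : i != j -> measurable A -> P (l i j @^-1` A) = F A.
Proof.
move=> ij mA; have := edge_edges ij; rewrite lE inE; case: (edge i j) => a b /=.
by move=> ab; exact: lF.
Qed.

Let star_sub x U : x \notin U -> star x U \subset edges.
Proof.
move=> xU; apply/fintype.subsetP => _ /imsetP[u uU ->]; apply: edge_edges.
by apply: contraNneq xU => ->.
Qed.

Let inner_sub U : inner U \subset edges.
Proof. by apply/fintype.subsetP => ij; rewrite inE => /andP[]. Qed.

Let star_inner x U : x \notin U -> forall ij, ij \in star x U -> ij \notin inner U.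
Proof.
move=> xU _ /imsetP[u uU ->]; rewrite inE /edge; case: ifP => _ /=;
  by rewrite (negbTE xU) !(andbF, andFb).
Qed.

Let star_disjoint x U V : (forall u, u \in U -> u \notin V) ->
  forall ij, ij \in star x U -> ij \notin star x V.
Proof.
move=> UV _ /imsetP[u uU ->]; apply/imsetP => -[v vV] /edge_inj uv.
by have := UV _ uU; rewrite uv vV.
Qed.

Let mX ij : measurable_fun setT (X ij). Proof. exact: ml. Qed.

(** The same set [T] with a coarser sigma-algebra: measurability for it expresses dependence on
    these edges alone. *)
Definition star_sigma x U := g_sigma_algebraType (cylinders X (star x U)).
Definition inner_sigma U := g_sigma_algebraType (cylinders X (inner U)).

Lemma star_measurable x U u : u \in U ->
  measurable_fun [set: star_sigma x U] (l x u : star_sigma x U -> R).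
Proof.
by move=> uU; rewrite lE; apply: cylinders_measurable_fun; exact: imset_f.
Qed.

Lemma inner_measurable U i j : i \in U -> j \in U -> i != j ->
  measurable_fun [set: inner_sigma U] (l i j : inner_sigma U -> R).
Proof.
move=> iU jU ij; rewrite lE; apply: cylinders_measurable_fun.
by rewrite inE edge_edges// /edge; case: ifP => /=; rewrite iU jU.
Qed.

(** This replaces conditional expectation: the blocks are fixed before the walk is run, so a step to
    a given city and the future after it are ordinary independent variables. *)
Lemma Ex_star_inner x U (Y Z : T -> R) : x \notin U ->
  nonneg_mfun (Y : star_sigma x U -> R) -> nonneg_mfun (Z : inner_sigma U -> R) ->
  Ex (fun w => Y w * Z w)%R = Ex Y * Ex Z.
Proof.
move=> xU [mY Y0] [mZ Z0].
have iYZ := independent_blocks mX (star_sub xU) (inner_sub U) (star_inner xU)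
  l_indep mY mZ.
pose Y' : {RV P >-> R} :=
  HB.pack Y (isMeasurableFun.Build _ _ _ _ _ (measurable_fun_block mX mY)).
pose Z' : {RV P >-> R} :=
  HB.pack Z (isMeasurableFun.Build _ _ _ _ _ (measurable_fun_block mX mZ)).
exact: (@ge0_integral_independentM _ _ _ _ Y' Z').
Qed.

(** Once sorted, the edges from [x] are distinct members of the independent family, and each has law
    [F]. *)
Lemma measure_star x U (B : set R) : x \notin U -> measurable B ->
  P [set w | forall u, u \in U -> B (l x u w)] = F B ^+ #|U|.
Proof.
move=> xU mB.
have := @measure_cylinder _ _ _ P _ X edges l_indep (star x U) (fun=> B)
  (star_sub xU) (fun=> mB).
rewrite (_ : [set w | _] = [set w | forall u, u \in U -> B (l x u w)]); last first.
  apply/seteqP; split=> w /= h => [u uU|_ /imsetP[u uU ->]].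
    by rewrite lE; apply: h; exact: imset_f.
  by rewrite -lE; exact: h.
move=> ->; rewrite big_imset/=; last by move=> u u' _ _ /edge_inj.
under eq_bigr => u uU.
  rewrite -lE lF_sym//; last by apply: contraNneq xU => ->.
  over.
by rewrite big_const; elim: #|U| => [|k IHk]; rewrite ?expe0// expeS /= IHk.
Qed.

(** The minimum over [U]; as real minima have no neutral element, it starts from the value at [u],
    meant to be a member of [U]. *)
Definition star_min x U u w : R := \big[Num.min/l x u w]_(v in U) l x v w.

Lemma star_min_attained x U u w : u \in U ->
  (exists2 v, v \in U & star_min x U u w = l x v w) /\
  (forall v, v \in U -> star_min x U u w <= l x v w)%R.
Proof.
move=> uU; have le v : v \in U -> (star_min x U u w <= l x v w)%R.
  by move=> vU; exact: bigmin_le_cond.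
split=> //.
case: (@Order.TotalTheory.arg_minP _ _ _ u (mem U) (l x ^~ w) uU) => v vU vmin.
exists v => //; apply/eqP; rewrite eq_le le//=.
by apply/bigmin_geP; split; [exact: vmin|exact: vmin].
Qed.

Lemma star_min_nonneg_mfun x U u : u \in U -> nonneg_mfun (star_min x U u).
Proof.
move=> uU; split; last first.
  by move=> w; have [[v _ ->] _] := star_min_attained x w uU.
by apply: measurable_big => // f g; exact: measurable_minr.
Qed.

Lemma star_min_measurable x U u : u \in U ->
  measurable_fun [set: star_sigma x U] (star_min x U u : star_sigma x U -> R).
Proof.
move=> uU; apply: measurable_big.
- by move=> f g; exact: measurable_minr.
- exact: star_measurable.
- by move=> v vU; exact: star_measurable.
Qed.

Lemma measurable_exprn_gt k (t : R) : measurable [set y : R | (t < y ^+ k)%R].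
Proof.
have : measurable_fun setT (fun y : R => (t < y ^+ k)%R).
  by apply: measurable_fun_ltr => //; exact: exprn_measurable.
by move=> /(_ measurableT [set true]); rewrite setTI; exact.
Qed.

Lemma measure_star_min_gt k x U u t : x \notin U -> u \in U ->
  P [set w | (t < star_min x U u w ^+ k)%R] = F [set y | (t < y ^+ k)%R] ^+ #|U|.
Proof.
move=> xU uU; rewrite -(measure_star xU (measurable_exprn_gt k t)).
congr (P _); apply/seteqP; split=> w /=.
  move=> tk v vU; apply: (lt_le_trans tk).
  have [_ /(_ v vU)] := star_min_attained x w uU.
  by apply: lerXn2r; rewrite nnegrE//; apply: (star_min_nonneg_mfun x uU).2.
by have [[v vU ->] _] := star_min_attained x w uU; exact.
Qed.

(* The [k]-th moment of the minimum of [m] independent variables of law [F],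
   through the tail formula. *)
Definition min_moment k m : \bar R :=
  \int[@lebesgue_measure R]_(t in `[0%R, +oo[) F [set y | (t < y ^+ k)%R] ^+ m.

Lemma Ex_star_min k x U u : x \notin U -> u \in U ->
  Ex (fun w => star_min x U u w ^+ k)%R = min_moment k #|U|.
Proof.
move=> xU uU; have [m0 n0] := nonneg_mfunX k (star_min_nonneg_mfun x uU).
pose Y : {RV P >-> R} := HB.pack (fun w => star_min x U u w ^+ k)%R
  (isMeasurableFun.Build _ _ _ _ _ m0).
have := @ge0_expectation_ccdf _ _ _ P Y n0; rewrite expectation_def => ->.
apply: eq_integral => t _; rewrite -(measure_star_min_gt _ _ xU uU).
by congr (P _); apply/seteqP; split=> w /=; rewrite in_itv/= andbT.
Qed.

Lemma independent_edges x u v : x != u -> x != v -> u != v ->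
  independent_functions P (l x u) (l x v).
Proof.
move=> xu xv uv; apply: (@independent_blocks _ _ _ _ _ X mX edges
  (star x [set u]%SET) (star x [set v]%SET)) => //.
- by apply: star_sub; rewrite inE.
- by apply: star_sub; rewrite inE.
- by apply: star_disjoint => i; rewrite !inE => /eqP ->.
- by apply: star_measurable; rewrite inE.
- by apply: star_measurable; rewrite inE.
Qed.

Let RVl i j : {RV P >-> R} :=
  HB.pack (l i j) (isMeasurableFun.Build _ _ _ _ _ (ml i j)).

(** Two edges at a common city are independent with an atomless law, so they coincide with
    probability zero, and there are finitely many such pairs. *)
Lemma ae_tie_free : {ae P, forall w, tie_free (fun i j => l i j w)}.
Proof.
apply: filter_forall => x; apply: filter_forall => u; apply: filter_forall => v.
have [xu|_] := boolP (x != u); last by apply: aeW => w.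
have [xv|_] := boolP (x != v); last by apply: aeW => w.
have [uv|_] := boolP (u != v); last by apply: aeW => w.
exists [set w | l x u w = l x v w]; split.
- have : measurable_fun setT (fun w => l x u w == l x v w).
    exact: measurable_fun_eqr.
  move=> /(_ measurableT [set true]); rewrite setTI.
  rewrite (_ : _ @^-1` _ = [set w | l x u w = l x v w]); first exact.
  by apply/seteqP; split=> w /= /eqP.
- apply: (@measure_eq_independent _ _ _ _ (RVl x u) (RVl x v)).
    exact: independent_edges.
  by move=> z; rewrite lF_sym.
- move=> w /= h; apply/eqP/negP => /negP h'; apply: h => _ _ _.
  exact: h'.
Qed.

Definition argmin x U u w : R := (strict_argmin (fun i j => l i j w) x U u)%:R.

Lemma argmin_nonneg_mfun x U u : u \in U -> nonneg_mfun (argmin x U u).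
Proof. by move=> uU; split=> //; apply: strict_argmin_measurable. Qed.

Lemma argmin_star_measurable x U u : u \in U ->
  nonneg_mfun (argmin x U u : star_sigma x U -> R).
Proof.
move=> uU; split=> //; apply: (@strict_argmin_measurable _ (star_sigma x U)) => //.
by move=> v vU; exact: star_measurable.
Qed.

(** Almost surely exactly one city is selected, and its distance is the minimum of the star. *)
Lemma sum_Ex_argmin_star_min k x U : x \notin U -> (0 < #|U|)%N ->
  \sum_(u in U) Ex (fun w => argmin x U u w * l x u w ^+ k)%R = min_moment k #|U|.
Proof.
move=> xU /card_gt0P[u0 u0U]; rewrite -(Ex_star_min k xU u0U) -Ex_sum; last first.
  move=> u uU; apply: nonneg_mfunM; first exact: argmin_nonneg_mfun.
  exact: nonneg_mfunX.
apply: ae_eq_Ex.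
- apply: nonneg_mfun_sum => u uU; apply: nonneg_mfunM.
    exact: argmin_nonneg_mfun.
  exact: nonneg_mfunX.
- exact/nonneg_mfunX/star_min_nonneg_mfun.
- apply: filterS ae_tie_free => w tf.
  have U0 : (0 < #|U|)%N by apply/card_gt0P; exists u0.
  have [u uU su] := ex_strict_argmin tf xU U0.
  rewrite (sum_strict_argmin (fun u => l x u w ^+ k)%R uU su); congr (_ ^+ _)%R.
  have [[v vU vE] le] := star_min_attained x w u0U.
  apply/eqP; rewrite eq_le le// andbT vE.
  have [->//|uv] := eqVneq u v.
  by move: su => /forall_inP/(_ v); rewrite !inE eq_sym uv => /(_ vU)/ltW.
Qed.

Lemma sum_Ex_argmin x U : x \notin U -> (0 < #|U|)%N ->
  \sum_(u in U) Ex (argmin x U u) = 1.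
Proof.
move=> xU U0; have := @sum_Ex_argmin_star_min 0 _ _ xU U0.
under eq_bigr do under eq_integral do rewrite expr0 mulr1.
move=> ->; have /card_gt0P[u uU] := U0.
rewrite -(Ex_star_min 0 xU uU); under eq_integral do rewrite expr0.
by rewrite integral_cst//= probability_setT mul1e.
Qed.

(* The right-hand side does not depend on [u]: all cities of [U] are equally
   likely to be the nearest one. *)
Lemma Ex_argmin_integral x U u v : x \notin U -> u \in U -> v \in U -> u != v ->
  Ex (argmin x U u) = \int[F]_y F `]y, +oo[%classic ^+ #|U|.-1.
Proof.
move=> xU uU vU uv; pose V := (U :\ u)%SET.
have vV : v \in V by rewrite !inE eq_sym uv.
have xV : x \notin V by rewrite !inE negb_and xU orbT.
have xu : x != u by apply: contraNneq xU => ->.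
(* The event compares one edge with the minimum of the others, which is built on a disjoint block of
   edges. *)
have saE w : strict_argmin (fun i j => l i j w) x U u = (l x u w < star_min x V v w)%R.
  have [[v' v'V v'E] le] := star_min_attained x w vV.
  apply/forall_inP/idP => [h|h v0 v0V]; first by rewrite v'E; exact: h.
  by rewrite (lt_le_trans h)// le.
rewrite /argmin; under eq_integral do rewrite saE.
have mV := (star_min_nonneg_mfun x vV).1.
have mlt : measurable [set w | (l x u w < star_min x V v w)%R].
  have : measurable_fun setT (fun w => (l x u w < star_min x V v w)%R).
    exact: measurable_fun_ltr.
  by move=> /(_ measurableT [set true]); rewrite setTI; exact.
rewrite Ex_bool//.
pose Z : {RV P >-> R} := HB.pack (star_min x V v) (isMeasurableFun.Build _ _ _ _ _ mV).
rewrite (@measure_lt_independent _ _ _ P (RVl x u) Z); last first.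
  apply: (@independent_blocks _ _ _ _ _ X mX edges
    (star x [set u]%SET) (star x V)) => //.
  - by apply: star_sub; rewrite inE.
  - exact: star_sub.
  - by apply: star_disjoint => i; rewrite !inE => /eqP ->; rewrite eqxx.
  - by apply: star_measurable; rewrite inE.
  - exact: star_min_measurable.
transitivity (\int[distribution P (RVl x u)]_y F `]y, +oo[%classic ^+ #|U|.-1).
  apply: eq_integral => y _.
  have -> : #|U|.-1 = #|V| by rewrite (cardsD1 u U) uU.
  have := @measure_star_min_gt 1 x V v y xV vV.
  have e1 (z : R) : (z ^+ 1)%R = z by rewrite expr1.
  have -> : [set w | (y < star_min x V v w ^+ 1)%R] = Z @^-1` `]y, +oo[%classic.
    by apply/seteqP; split=> w /=; rewrite in_itv/= andbT.
  move=> ->; congr (F _ ^+ _); apply/seteqP; split=> w /=;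
    by rewrite in_itv/= andbT.
by apply: eq_measure_integral => A mA _; exact: lF_sym.
Qed.

(** The probabilities of selecting the cities of [U] are all equal and sum to [1]. Finiteness is
    established before passing to real numbers to divide. *)
Lemma Ex_argmin x U u : x \notin U -> u \in U ->
  Ex (argmin x U u) = (#|U|%:R^-1)%:E.
Proof.
move=> xU uU; have U0 : (0 < #|U|)%N by apply/card_gt0P; exists u.
have := sum_Ex_argmin xU U0.
under eq_bigr => v vU.
  rewrite (_ : Ex _ = Ex (argmin x U u)); last first.
    have [->//|uv] := eqVneq v u.
    by rewrite (Ex_argmin_integral xU vU uU uv) (Ex_argmin_integral xU uU vU _) // eq_sym.
  over.
have [_ sa0] := argmin_nonneg_mfun x uU.
have fin : Ex (argmin x U u) \is a fin_num.
  rewrite ge0_fin_numE; last exact/Ex_ge0/argmin_nonneg_mfun.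
  apply: (@le_lt_trans _ _ (Ex (fun=> 1%R))).
    apply: le_Ex; [exact: argmin_nonneg_mfun|exact: nonneg_mfun_cst|].
    by move=> w; rewrite lern1 leq_b1.
  by rewrite integral_cst//= probability_setT mul1e ltry.
rewrite -(fineK fin) sumEFin => -[] /eqP.
rewrite sumr_const => /eqP h; congr (_%:E).
by apply: (@mulIf _ #|U|%:R); rewrite ?pnatr_eq0 -?lt0n//
  mulr_natr h mulVf// pnatr_eq0 -lt0n.
Qed.

(** * Mean, second moment and last city of the walk *)

Section walk_moments.
Variables a q : nat -> R.
Hypotheses (aE : forall m, min_moment 1 m.+1 = (a m.+1)%:E)
  (qE : forall m, min_moment 2 m.+1 = (q m.+1)%:E).

Let lw w i j := l i j w.

Definition walk_length m x U w : R := greedy_walk (lw w) (lw w) (fun=> 0%R) m x U.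

(* The indicator that the walk ends in [j]: no step costs, the last city pays. *)
Definition walk_hit j m x U w : R :=
  greedy_walk (lw w) (fun _ _ => 0%R) (fun i => (i == j)%:R) m x U.

Lemma walk_length_inner m U u : u \in U ->
  nonneg_mfun (walk_length m u (U :\ u)%SET : inner_sigma U -> R).
Proof.
move=> uU; apply: (@greedy_walk_nonneg _ (inner_sigma U) _ _ l l (fun=> 0%R) U) => //.
- exact: inner_measurable.
- by move=> i j iU jU ij; split=> //; exact: inner_measurable.
- by rewrite subD1set.
- by rewrite !inE eqxx.
Qed.

Lemma walk_hit_inner j m U u : u \in U ->
  nonneg_mfun (walk_hit j m u (U :\ u)%SET : inner_sigma U -> R).
Proof.
move=> uU; apply: (@greedy_walk_nonneg _ (inner_sigma U) _ _ l (fun _ _ => cst 0%R)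
  (fun i => (i == j)%:R) U) => //.
- exact: inner_measurable.
- by rewrite subD1set.
- by rewrite !inE eqxx.
Qed.

Lemma walk_length_nonneg m x U : x \notin U -> nonneg_mfun (walk_length m x U).
Proof.
by move=> xU; apply: (@greedy_walk_nonneg _ _ _ _ l l (fun=> 0%R) [set: I]%SET).
Qed.

Lemma argminl_star k x U u v : u \in U -> v \in U ->
  nonneg_mfun ((fun w => argmin x U u w * l x v w ^+ k)%R : star_sigma x U -> R).
Proof.
move=> uU vU; apply: nonneg_mfunM; first exact: argmin_star_measurable.
by apply: nonneg_mfunX; split=> //; exact: star_measurable.
Qed.

Lemma argminl_nonneg k x U u i j : u \in U ->
  nonneg_mfun (fun w => argmin x U u w * l i j w ^+ k)%R.
Proof.
by move=> uU; apply: nonneg_mfunM; [exact: argmin_nonneg_mfun|exact: nonneg_mfunX].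
Qed.

Let setD1_card U u m : u \in U -> #|U| = m.+1 -> #|(U :\ u)%SET| = m.
Proof. by move=> uU; rewrite (cardsD1 u U) uU => -[]. Qed.

Let setD1_notin U u : u \notin (U :\ u)%SET. Proof. by rewrite !inE eqxx. Qed.

(** After splitting by the next city, the mean of the rest is the same for every choice and leaves
    the sum, where the indicators have total expectation [1]. *)
Lemma Ex_walk_length m x U : x \notin U -> #|U| = m ->
  Ex (walk_length m x U) = (\sum_(1 <= k < m.+1) a k)%R%:E.
Proof.
elim: m x U => [|m IHm] x U xU Um.
  by rewrite big_geq//= integral0_eq.
have U0 : (0 < #|U|)%N by rewrite Um.
have wE w : walk_length m.+1 x U w = (\sum_(u in U) (argmin x U u w * l x u w ^+ 1 +
    argmin x U u w * walk_length m u (U :\ u)%SET w))%R.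
  by apply: eq_bigr => u _; rewrite expr1 -mulrDr.
under eq_integral do rewrite wE.
have nl u : u \in U -> nonneg_mfun (fun w => argmin x U u w * l x u w ^+ 1)%R.
  by move=> uU; exact: argminl_nonneg.
have nw u : u \in U ->
    nonneg_mfun (fun w => argmin x U u w * walk_length m u (U :\ u)%SET w)%R.
  move=> uU; apply: nonneg_mfunM; first exact: argmin_nonneg_mfun.
  exact: walk_length_nonneg.
rewrite Ex_sum; last by move=> u uU; apply: nonneg_mfunD; [exact: nl|exact: nw].
under eq_bigr => u uU.
  rewrite ExD; [|exact: nl|exact: nw].
  rewrite [X in _ + X](Ex_star_inner xU);
    [|exact: argmin_star_measurable|exact: walk_length_inner].
  rewrite IHm//; last exact: setD1_card.
  over.
rewrite big_split/= sum_Ex_argmin_star_min// Um aE -ge0_sume_distrl; last first.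
  by move=> u uU; exact/Ex_ge0/argmin_nonneg_mfun.
by rewrite sum_Ex_argmin// mul1e -EFinD [in RHS]big_nat_recr//= addrC.
Qed.

(** The variance bound in the form of a second moment. The square of step plus rest is expanded
    inside the sum over next cities; the cross term factors by independence and uses the mean
    already known. *)
Lemma Ex_walk_length_sqr m x U : x \notin U -> #|U| = m ->
  Ex (fun w => walk_length m x U w ^+ 2)%R <=
  ((\sum_(1 <= k < m.+1) a k) ^+ 2 + \sum_(1 <= k < m.+1) q k)%R%:E.
Proof.
elim: m x U => [|m IHm] x U xU Um.
  rewrite integral0_eq; first by rewrite !big_geq// addr0 expr0n.
  by move=> w _; rewrite /walk_length/= expr0n.
have U0 : (0 < #|U|)%N by rewrite Um.
set s := (\sum_(1 <= k < m.+1) a k)%R; set Q := (\sum_(1 <= k < m.+1) q k)%R.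
pose W u := walk_length m u (U :\ u)%SET.
have wE w : (walk_length m.+1 x U w ^+ 2 = \sum_(u in U) (argmin x U u w * l x u w ^+ 2 +
    (2 * ((argmin x U u w * l x u w ^+ 1) * W u w) + argmin x U u w * W u w ^+ 2)))%R.
  rewrite /walk_length/= sqr_sum_strict_argmin; apply: eq_bigr => u _.
  by rewrite /argmin /W /walk_length /lw expr1; ring.
under eq_integral do rewrite wE.
have nl k u : u \in U -> nonneg_mfun (fun w => argmin x U u w * l x u w ^+ k)%R.
  by move=> uU; exact: argminl_nonneg.
have nW u : nonneg_mfun (W u) by exact: walk_length_nonneg.
have nlW u : u \in U -> nonneg_mfun (fun w => argmin x U u w * l x u w ^+ 1 * W u w)%R.
  by move=> uU; apply: nonneg_mfunM => //; exact: nl.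
have n2lW u : u \in U ->
    nonneg_mfun (fun w => 2 * (argmin x U u w * l x u w ^+ 1 * W u w))%R.
  by move=> uU; apply: nonneg_mfunM; [exact: nonneg_mfun_cst|exact: nlW].
have nW2 u : u \in U -> nonneg_mfun (fun w => argmin x U u w * W u w ^+ 2)%R.
  by move=> uU; apply: nonneg_mfunM; [exact: argmin_nonneg_mfun|exact: nonneg_mfunX].
have s0 : (0 <= s)%R.
  rewrite /s big_nat; apply: sumr_ge0 => -[|k]// _.
  by rewrite -lee_fin -aE; apply: integral_ge0 => t _; exact: expe_ge0.
rewrite Ex_sum; last first.
  move=> u uU; apply: nonneg_mfunD; first exact: nl.
  by apply: nonneg_mfunD; [exact: n2lW|exact: nW2].
have le1 u : u \in U -> Ex (fun w => argmin x U u w * l x u w ^+ 2 +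
    (2 * ((argmin x U u w * l x u w ^+ 1) * W u w) + argmin x U u w * W u w ^+ 2))%R <=
    Ex (fun w => argmin x U u w * l x u w ^+ 2)%R +
    (Ex (fun w => argmin x U u w * l x u w ^+ 1)%R * (2 * s)%:E +
     Ex (argmin x U u) * (s ^+ 2 + Q)%:E).
  move=> uU; rewrite ExD; [|exact: nl|by apply: nonneg_mfunD; [exact: n2lW|exact: nW2]].
  rewrite ExD; [|exact: n2lW|exact: nW2].
  apply: leeD => //; apply: leeD.
    rewrite ExZl//; last exact: nlW.
    rewrite (Ex_star_inner xU (argminl_star 1 x uU uU) (walk_length_inner m uU)).
    rewrite Ex_walk_length//; last exact: setD1_card.
    by rewrite EFinM muleCA muleA.
  rewrite (Ex_star_inner xU (argmin_star_measurable x uU)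
    (nonneg_mfunX 2 (walk_length_inner m uU))).
  apply: lee_pmul => //; [exact/Ex_ge0/argmin_nonneg_mfun
    |exact: (Ex_ge0 P (nonneg_mfunX 2 (nW u)))|].
  by apply: IHm => //; exact: setD1_card.
apply: (le_trans (lee_sum _ le1)).
rewrite big_split/= [X in _ + X <= _]big_split/= -ge0_sume_distrl;
  last by move=> u uU; exact/Ex_ge0/nl.
rewrite -ge0_sume_distrl; last first.
  by move=> u uU; exact/Ex_ge0/argmin_nonneg_mfun.
rewrite !sum_Ex_argmin_star_min// sum_Ex_argmin// Um aE qE mul1e -EFinM -!EFinD lee_fin.
have -> : (\sum_(1 <= k < m.+2) a k = s + a m.+1)%R by rewrite big_nat_recr.
have -> : (\sum_(1 <= k < m.+2) q k = Q + q m.+1)%R by rewrite big_nat_recr.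
(* The slack is exactly [a m.+1 ^+ 2], lost when the variance of the step is bounded by its second
   moment. *)
by have := sqr_ge0 (a m.+1); nra.
Qed.

Lemma walk_hit_nonneg j m x U : x \notin U -> nonneg_mfun (walk_hit j m x U).
Proof.
by move=> xU; apply: (@greedy_walk_nonneg _ _ _ _ l (fun _ _ => cst 0%R)
  (fun i => (i == j)%:R) [set: I]%SET).
Qed.

(** In the inductive step the first city differs from [j] in [m.+1] ways, each of probability
    [1 / m.+2], and then [j] comes last with probability at most [1 / m.+1]. *)
Lemma Ex_walk_hit j m x U : x \notin U -> #|U| = m.+1 -> j \in U ->
  Ex (walk_hit j m.+1 x U) <= (m.+1%:R^-1)%:E.
Proof.
elim: m x U => [|m IHm] x U xU Um jU.
all: have nhit u k : u \in U ->
    nonneg_mfun (fun w => argmin x U u w * walk_hit j k u (U :\ u)%SET w)%R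
  by move=> uU; apply: nonneg_mfunM;
    [exact: argmin_nonneg_mfun|exact: walk_hit_nonneg].
all: have wE k w : walk_hit j k.+1 x U w =
    (\sum_(u in U) argmin x U u w * walk_hit j k u (U :\ u)%SET w)%R
  by apply: eq_bigr => u _; rewrite add0r.
all: under eq_integral do rewrite wE.
all: rewrite Ex_sum; last by move=> u uU; exact: nhit.
all: rewrite (bigD1 j)//=.
  rewrite big1 ?adde0; last first.
    move=> u /andP[_ /negbTE uj]; rewrite integral0_eq// => w _.
    by rewrite /walk_hit/= uj mulr0.
  under eq_integral do rewrite /walk_hit/= eqxx mulr1.
  by rewrite Ex_argmin// Um.
(* If the first step goes to [j], the rest of the walk cannot end there. *)
rewrite integral0_eq ?add0e; last first.
  by move=> w _; rewrite /walk_hit greedy_walk_off ?mulr0// !inE eqxx.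
apply: (@le_trans _ _ (\sum_(u in U | u != j) (m.+2%:R^-1 * m.+1%:R^-1)%:E)).
  apply: lee_sum => u /andP[uU uj].
  rewrite (Ex_star_inner xU (argmin_star_measurable x uU) (walk_hit_inner j m.+1 uU)).
  rewrite Ex_argmin// Um EFinM; apply: lee_pmul => //.
  - exact/Ex_ge0/walk_hit_nonneg.
  - apply: IHm; [exact: setD1_notin|exact: setD1_card|].
    by rewrite !inE eq_sym uj.
rewrite sumEFin lee_fin sumr_const.
have -> : #|[pred u in U | u != j]| = m.+1.
  rewrite -(setD1_card jU Um); by apply: eq_card => u; rewrite !inE andbC.
by rewrite -[leLHS]mulr_natr -mulrA mulVf ?mulr1// pnatr_eq0.
Qed.

Lemma Ex_edge_sqr x j : x != j -> Ex (fun w => l x j w ^+ 2)%R = (q 1)%:E.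
Proof.
move=> xj; have xU : x \notin [set j]%SET by rewrite inE.
have jU : j \in [set j]%SET by rewrite inE.
transitivity (min_moment 2 #|[set j]%SET|); last by rewrite cards1 qE.
rewrite -(Ex_star_min 2 xU jU); apply: eq_integral => w _.
have [[v vj ->] _] := star_min_attained x w jU.
by rewrite inE in vj; rewrite (eqP vj).
Qed.

Let others : {set I} := (~: [set ord0])%SET.

Definition last_edge_term u j w : R := (argmin ord0 others u w * l ord0 j w ^+ 2 *
  walk_hit j n.-1 u (others :\ u)%SET w)%R.

Let ord0_others : ord0 \notin others. Proof. by rewrite !inE eqxx. Qed.

Let card_others : #|others| = n. Proof. by rewrite cardsC1 card_ord. Qed.

Lemma last_edge_term_nonneg u j : u \in others -> nonneg_mfun (last_edge_term u j).
Proof.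
move=> uU; apply: nonneg_mfunM; last exact: walk_hit_nonneg.
exact: argminl_nonneg.
Qed.

(* The last edge was already seen at the first step, but its end is uniform among
   the cities not chosen then, and independent of the first star. *)
Lemma Ex_last_edge : (1 < n)%N ->
  Ex (fun w => \sum_(u in others) \sum_(j in others :\ u) last_edge_term u j w)%R <=
  (2 * q 1)%:E.
Proof.
move=> n1; have n0 : (0 < n)%N by exact: ltn_trans n1.
have q0 : (0 <= q 1)%R.
  by rewrite -lee_fin -qE; apply: integral_ge0 => t _; exact: expe_ge0.
rewrite Ex_sum; last first.
  by move=> u uU; apply: nonneg_mfun_sum => j _; exact: last_edge_term_nonneg.
have nl u j : u \in others ->
    nonneg_mfun (fun w => argmin ord0 others u w * l ord0 j w ^+ 2)%R.
  exact: argminl_nonneg.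
pose c : R := (n.-1%:R^-1)%R.
have c0 : (0 <= c)%R by rewrite invr_ge0.
have le1 u : u \in others ->
    Ex (fun w => \sum_(j in others :\ u) last_edge_term u j w)%R <=
    \sum_(j in others) Ex (fun w => argmin ord0 others u w * l ord0 j w ^+ 2)%R * c%:E.
  move=> uU; rewrite Ex_sum; last by move=> j _; exact: last_edge_term_nonneg.
  (* The nonnegative term [j = u] is added so that the range of [j] no longer depends on [u] and the
     sums can be exchanged. *)
  rewrite [leRHS](big_setD1 u)//= -[leLHS]add0e; apply: leeD.
    by apply: mule_ge0; [exact/Ex_ge0/nl|rewrite lee_fin].
  apply: lee_sum => j jU; have jo : j \in others by move: jU; rewrite inE => /andP[].
  rewrite /last_edge_term (Ex_star_inner ord0_others
    (argminl_star 2 ord0 uU jo) (walk_hit_inner j n.-1 uU)).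
  apply: lee_pmul => //; [exact/Ex_ge0/nl|exact/Ex_ge0/walk_hit_nonneg|].
  have cU : #|(others :\ u)%SET| = n.-2.+1.
    by apply: setD1_card => //; rewrite card_others; move: n1; case: (n) => [|[]].
  have := Ex_walk_hit (setD1_notin _ _) cU jU.
  by rewrite /c prednK; [exact|rewrite -ltnS prednK].
apply: (le_trans (lee_sum _ le1)); rewrite exchange_big/=.
apply: (@le_trans _ _ (\sum_(j in others) (q 1 * c)%:E)).
  apply: lee_sum => j jo; rewrite -ge0_sume_distrl; last first.
    by move=> u uo; exact/Ex_ge0/nl.
  rewrite EFinM; apply: lee_wpmul2r; first by rewrite lee_fin.
  rewrite -Ex_sum; last by move=> u uo; exact: nl.
  rewrite -(@Ex_edge_sqr ord0 j); last by apply: contraNneq ord0_others => ->.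
  apply: le_Ex; [by apply: nonneg_mfun_sum => u uo; exact: nl|exact: nonneg_mfunX|].
  move=> w; rewrite -mulr_suml ler_piMl ?exprn_ge0//.
  have [/exists_inP[u uU su]|/exists_inPn sN] :=
      boolP [exists u in others, strict_argmin (lw w) ord0 others u].
    rewrite (bigD1 u)//= big1 ?addr0 ?lern1 ?leq_b1// => v /andP[vU vu].
    rewrite /argmin; case: (boolP (strict_argmin _ _ _ v)) => // sv.
    by rewrite (strict_argmin_uniq vU uU sv su) eqxx in vu.
  by rewrite big1 ?ler01// => u /sN/negbTE; rewrite /argmin => ->.
rewrite sumEFin lee_fin sumr_const card_others -[leLHS]mulr_natr -mulrA mulrC.
rewrite ler_wpM2r//.
(* What remains is [n / n.-1 <= 2]. *)
have x1 : (1 <= n.-1%:R :> R)%R by rewrite ler1n -ltnS prednK.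
have -> : (n%:R = n.-1%:R + 1 :> R)%R by rewrite natr1 prednK.
rewrite /c mulrC ler_pdivrMr; first lra.
exact: lt_le_trans x1.
Qed.

(** The closing edge is split off by [(x + y)^2 <= 2 x^2 + 2 y^2]; the walk contributes its variance
    bound and its squared bias with respect to [c]. *)
Lemma Ex_tour_length_error (v : T -> nat -> I) (L : T -> R) (c : R) :
  (1 < n)%N -> (0 <= c)%R -> measurable_fun setT L ->
  {ae P, forall w, NN_tour (lw w) (v w) /\ L w = tour_length (lw w) (v w)} ->
  Ex (fun w => (L w - c) ^+ 2)%R <=
  (2 * (\sum_(1 <= k < n.+1) q k + (\sum_(1 <= k < n.+1) a k - c) ^+ 2 + 2 * q 1))%:E.
Proof.
move=> n1 c0 mL vL.
set s := (\sum_(1 <= k < n.+1) a k)%R; set Q := (\sum_(1 <= k < n.+1) q k)%R.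
pose W := walk_length n ord0 others.
have nW : nonneg_mfun W by exact: walk_length_nonneg.
have nWc : nonneg_mfun (fun w => (W w - c) ^+ 2)%R.
  split; last by move=> w; rewrite sqr_ge0.
  by apply: measurable_funX; apply: measurable_funB => //; exact: nW.1.
have nZ : nonneg_mfun
    (fun w => \sum_(u in others) \sum_(j in others :\ u) last_edge_term u j w)%R.
  by apply: nonneg_mfun_sum => u uo; apply: nonneg_mfun_sum => j _;
    exact: last_edge_term_nonneg.
have n2 (f : T -> R) : nonneg_mfun f -> nonneg_mfun (fun w => 2 * f w)%R.
  by move=> nf; apply: nonneg_mfunM => //; exact: nonneg_mfun_cst.
have EW : Ex (fun w => (W w - c) ^+ 2)%R <= (Q + (s - c) ^+ 2)%:E.
  (* The cross term is moved to the left so that both sides are expectations of nonnegative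
     functions; its finite value is cancelled afterwards. *)
  have : Ex (fun w => (W w - c) ^+ 2 + (2 * c) * W w)%R =
      Ex (fun w => W w ^+ 2 + c ^+ 2)%R.
    by apply: eq_integral => w _; congr (_%:E); ring.
  have c20 : (0 <= 2 * c)%R by rewrite mulr_ge0.
  have nc : nonneg_mfun (fun w => (2 * c) * W w)%R.
    by apply: nonneg_mfunM => //; exact: nonneg_mfun_cst.
  rewrite ExD// ExZl// (Ex_walk_length ord0_others card_others).
  rewrite ExD; [|exact: nonneg_mfunX|exact/nonneg_mfun_cst/sqr_ge0].
  rewrite integral_cst//= probability_setT mule1 -EFinM => h.
  rewrite -(@leeD2rE _ (2 * c * s)%:E)// h.
  apply: (le_trans (leeD2r _ (Ex_walk_length_sqr ord0_others card_others))).
  by rewrite -!EFinD lee_fin -/s -/Q le_eqVlt; apply/orP; left; apply/eqP; ring.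
apply: (@le_trans _ _ (Ex (fun w => 2 * (W w - c) ^+ 2 +
    2 * \sum_(u in others) \sum_(j in others :\ u) last_edge_term u j w)%R)).
  apply: ae_ge0_le_integral => //.
  - by move=> w _; rewrite lee_fin sqr_ge0.
  - by apply/measurable_EFinP; apply: measurable_funX; exact: measurable_funB.
  - by move=> w _; rewrite lee_fin; apply: (nonneg_mfunD (n2 _ nWc) (n2 _ nZ)).2.
  - by apply/measurable_EFinP; apply: (nonneg_mfunD (n2 _ nWc) (n2 _ nZ)).1.
  - apply: filterS2 ae_tie_free vL => w tf [vw ->] _; rewrite lee_fin.
    rewrite (tour_length_greedy_walk tf vw).
    have := last_edge_sqr tf vw n1.
    rewrite (_ : \sum_(u in _) _ =
      \sum_(u in others) \sum_(j in others :\ u) last_edge_term u j w)%R; last first.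
      apply: eq_bigr => u _; apply: eq_bigr => j _.
      by rewrite /last_edge_term /lw /argmin (lC ord0 j).
    move=> <-; rewrite -/(walk_length n ord0 others w) -/W.
    set e := l _ ord0 w; set z := W w.
    have := sqr_ge0 (z - c - e)%R; nra.
rewrite ExD; [|exact: n2|exact: n2].
rewrite !ExZl// -muleDr//; last by rewrite ge0_adde_def// inE; exact: Ex_ge0.
rewrite EFinM; apply: lee_wpmul2l; first by rewrite lee_fin.
by rewrite EFinD; apply: leeD => //; exact: Ex_last_edge.
Qed.
End walk_moments.

End mean_field.

(** * Stretched exponential integrals *)

Section exponential_integrals.
Context (R : realType).
Local Open Scope ereal_scope.
Notation mu := (@lebesgue_measure R).

Lemma continuous_expRM (k : R) : continuous (fun y : R => expR (k * y)%R).
Proof.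
move=> y; apply: continuous_comp; last exact: continuous_expR.
by apply: (@mulrl_continuous _ k).
Qed.

Lemma integral_expRN (k s : R) : (0 < k)%R ->
  \int[mu]_(y in `[s, +oo[) (expR (- k * y))%:E = (expR (- k * s) / k)%:E.
Proof.
move=> k0; pose G : R -> R := (- k^-1)%R \*: (expR \o ((- k)%R \*: (@id R))).
have GE y : G y = (- k^-1 * expR (- k * y))%R by [].
have dG (y : R) : is_derive y (1 : R)%R G (expR (- k * y)).
  apply: (@is_derive_eq _ _ _ _ _ _ _ (- k^-1 *: (expR (- k * y) * (- k *: 1)))%R).
  rewrite /GRing.scale/= mulr1 mulrC -mulrA mulrNN mulfV ?mulr1//.
  by rewrite gt_eqF.
rewrite (@ge0_continuous_FTC2y _ _ G _ 0).
- by rewrite -EFinB GE sub0r mulNr opprK mulrC.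
- by move=> y _; rewrite expR_ge0.
- by apply: continuous_subspaceT; exact: continuous_expRM.
- rewrite -[X in _ --> X](mulr0 (- k^-1)%R); apply: cvgM; first exact: cvg_cst.
  rewrite (_ : expR \o _ = (fun y : R => expR (- y)) \o (fun y => k * y)%R); last first.
    by apply/funext => y; rewrite /= /GRing.scale/= mulNr.
  apply: (@cvg_comp _ _ _ _ _ _ (pinfty_nbhs R)); last exact: cvgr_expR.
  exact: gt0_cvgMry.
- by move=> y _; case: (dG y).
- apply: cvg_at_right_filter; apply: cvgM; first exact: cvg_cst.
  exact: continuous_expRM.
- by move=> y _; rewrite derive1E; case: (dG y).
Qed.

(** Moves the domain into the integrand, where it becomes part of the constraint of a double
    integral. *)
Lemma integral_restrict_bool (f : R -> R) (b : R -> bool) (D : set R) :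
  (forall x, D x <-> b x) ->
  \int[mu]_(x in D) (f x)%:E = \int[mu]_x ((b x)%:R * f x)%:E.
Proof.
move=> Db; rewrite integral_mkcond; apply: eq_integral => x _.
rewrite patchE; case: (boolP (b x)) => bx.
  by rewrite mem_set ?mul1r//; exact/Db.
by rewrite memNset ?mul0r// => /Db; exact/negP.
Qed.

Lemma powR_ler_inv (t y g : R) : (0 < g)%R -> (0 <= t)%R -> (0 <= y)%R ->
  (t `^ g <= y)%R = (t <= y `^ g^-1)%R.
Proof.
move=> g0 t0 y0; have gN0 : g != 0%R by rewrite gt_eqF.
apply/idP/idP => h.
  rewrite -[leLHS]powRr1// -(mulfV gN0) powRrM.
  by apply: ge0_ler_powR; rewrite ?invr_ge0 ?nnegrE ?powR_ge0// ltW.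
rewrite -[leRHS]powRr1// -(mulVf gN0) powRrM.
by apply: ge0_ler_powR; rewrite ?nnegrE ?powR_ge0// ltW.
Qed.

(* Both sides integrate [exp (- y)] over the pairs [(t, y)] with [c t^g <= y]. *)
Lemma stretched_exponential_tonelli (c g : R) : (0 < c)%R -> (0 < g)%R ->
  \int[mu]_(t in `[0%R, +oo[) (expR (- (c * t `^ g)))%:E =
  \int[mu]_(y in `[0%R, +oo[) ((y / c) `^ g^-1 * expR (- y))%:E.
Proof.
move=> c0 g0.
pose f (z : (R * R)%type) : R :=
  (((0 <= z.1) && (c * z.1 `^ g <= z.2))%R%:R * expR (- z.2))%R.
have mf : measurable_fun setT f.
  have mb : measurable_fun setT (fun b : bool => b%:R : R) by [].
  apply: measurable_funM.
    apply: (measurableT_comp mb); apply: measurable_and.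
      by apply: measurable_fun_ler => //; exact: measurable_fst.
    apply: measurable_fun_ler; last exact: measurable_snd.
    apply: measurable_funM => //.
    by apply: (measurableT_comp (@measurable_powR R g)); exact: measurable_fst.
  apply: (measurableT_comp (@measurable_expR R)).
  by apply: measurableT_comp => //; exact: measurable_snd.
have f0 z : (0 <= f z)%R by rewrite mulr_ge0 ?expR_ge0.
have := @fubini_tonelli _ _ _ _ _ mu mu (EFin \o f)
  (measurableT_comp (@EFin_measurable _ _) mf) (fun z => f0 z).
rewrite /=.
have -> : \int[mu]_x \int[mu]_y (f (x, y))%:E =
    \int[mu]_(t in `[0%R, +oo[) (expR (- (c * t `^ g)))%:E.
  rewrite [RHS](@integral_restrict_bool _ (fun t => 0 <= t)%R); last first.
    by move=> t /=; rewrite in_itv/= andbT.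
  apply: eq_integral => t _; rewrite /f/=.
  case: (boolP (0 <= t)%R) => t0 /=; last first.
    by rewrite integral0_eq ?mul0r// => y _; rewrite mul0r.
  rewrite -(@integral_restrict_bool (fun y => expR (- y))
    (fun y => c * t `^ g <= y)%R `[(c * t `^ g)%R, +oo[%classic); last first.
    by move=> y /=; rewrite in_itv/= andbT.
  rewrite mul1r; have := @integral_expRN 1 (c * t `^ g)%R ltr01.
  rewrite divr1 mulN1r => <-.
  by apply: eq_integral => y _; rewrite mulN1r.
move=> ->.
rewrite [RHS](@integral_restrict_bool _ (fun t => 0 <= t)%R); last first.
  by move=> t /=; rewrite in_itv/= andbT.
apply: eq_integral => y _; rewrite /f/=.
case: (boolP (0 <= y)%R) => y0; last first.
  rewrite integral0_eq ?mul0r// => t _.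
  rewrite (_ : (c * t `^ g <= y)%R = false) ?andbF ?mul0r//.
  apply/negbTE; rewrite -ltNge (@lt_le_trans _ _ 0%R) ?ltNge//.
  by rewrite mulr_ge0 ?powR_ge0// ltW.
pose h := ((y / c) `^ g^-1)%R.
rewrite -(@integral_restrict_bool (fun _ => expR (- y))
  (fun t => (0 <= t) && (c * t `^ g <= y))%R `[0%R, h]%classic); last first.
  move=> t /=; rewrite in_itv/=; case: (boolP (0 <= t)%R) => t0 //=.
  by rewrite -ler_pdivlMl// powR_ler_inv// ?mulr_ge0 ?invr_ge0 ?(ltW c0)// mulrC.
rewrite integral_cst//= lebesgue_measure_itv/= lte_fin mul1r /h.
have : (0 <= (y / c) `^ g^-1)%R by exact: powR_ge0.
rewrite le_eqVlt => /orP[/eqP <-|->].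
  by rewrite ltxx mule0 mul0r.
by rewrite oppr0 adde0 -EFinM mulrC.
Qed.

(** From [exp (y / 2) >= 1 + y^2 / 8] and [y^a <= 1 + y^2], the integrand is at most
    [8 exp (- y / 2)]. *)
Lemma Gamma_integral_fin (a : R) : (0 <= a)%R -> (a <= 2)%R ->
  \int[mu]_(y in `[0%R, +oo[) (y `^ a * expR (- y))%:E \is a fin_num.
Proof.
move=> a0 a2; rewrite ge0_fin_numE; last first.
  by apply: integral_ge0 => y _; rewrite lee_fin mulr_ge0 ?powR_ge0 ?expR_ge0.
apply: (@le_lt_trans _ _
  (\int[mu]_(y in `[0%R, +oo[) (8%:E * (expR (- (2^-1) * y))%:E))).
  apply: ge0_le_integral => //.
  - by move=> y _; rewrite lee_fin mulr_ge0 ?powR_ge0 ?expR_ge0.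
  - apply: measurable_funTS; apply/measurable_EFinP; apply: measurable_funM.
      exact: measurable_powR.
    by apply: (measurableT_comp (@measurable_expR R)).
  - apply: measurable_funTS; apply/measurable_EFinP; apply: measurable_funM => //.
    by apply: (measurableT_comp (@measurable_expR R)).
  move=> y; rewrite /= in_itv/= andbT => y0; rewrite -EFinM lee_fin.
  have -> : (- y = - 2^-1 * y + - 2^-1 * y)%R by lra.
  rewrite expRD mulrA ler_wpM2r ?expR_ge0//.
  rewrite mulNr expRN ler_pdivrMr ?expR_gt0//.
  have := @expR_ge1Dxn _ (2^-1 * y)%R 1 (mulr_ge0 _ y0) => /(_ _)/wrap[].
    by rewrite invr_ge0.
  rewrite (_ : 2`!%:R = 2%R :> R)// exprMn => he.
  have : (y `^ a <= 1 + y ^+ 2)%R.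
    have [y1|/ltW y1] := leP y 1%R.
      have : (y `^ a <= 1)%R.
        have [->|yN0] := eqVneq y 0%R.
          by have [->|aN0] := eqVneq a 0%R; rewrite ?powRr0// powR0.
        rewrite -(powRr0 y); apply: ger_powR => //.
        by rewrite y1 lt0r yN0 y0.
      by have := sqr_ge0 y; lra.
    have : (y `^ a <= y ^+ 2)%R by rewrite -powR_mulrn//; exact: ler_powR.
    lra.
  move=> hy; apply: (le_trans hy); move: he; lra.
rewrite ge0_integralZl//; first by rewrite integral_expRN// -EFinM ltry.
apply: measurable_funTS; apply/measurable_EFinP.
by apply: (measurableT_comp (@measurable_expR R)).
Qed.

(** The substitution [y = c t^g] in the Gamma integral, carried out by exchanging integrals. The
    range of [g] covers the exponents [(1 + alpha) / k], [k <= 2], of the first two moments. *)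
Lemma stretched_exponential_integral (c g : R) : (0 < c)%R -> (2^-1 <= g)%R ->
  \int[mu]_(t in `[0%R, +oo[) (expR (- (c * t `^ g)))%:E =
  (c `^ (- g^-1) * Gamma (1 + g^-1))%:E.
Proof.
move=> c0 g2; have g0 : (0 < g)%R by apply: lt_le_trans g2; rewrite invr_gt0.
rewrite stretched_exponential_tonelli//.
have gi0 : (0 <= g^-1)%R by rewrite invr_ge0 ltW.
have gi2 : (g^-1 <= 2)%R by rewrite -[leRHS]invrK lef_pV2// posrE invr_gt0.
transitivity (\int[mu]_(y in `[0%R, +oo[)
    ((c `^ (- g^-1))%:E * (y `^ g^-1 * expR (- y))%:E)).
  apply: eq_integral => y; rewrite inE/= in_itv/= andbT => y0.
  rewrite -EFinM mulrA; congr (_ * _)%:E.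
  by rewrite powRM ?invr_ge0// ?(ltW c0)// mulrC -powR_inv1 ?(ltW c0)// -powRrM mulN1r.
rewrite ge0_integralZl//; last 3 first.
- apply: measurable_funTS; apply/measurable_EFinP; apply: measurable_funM.
    exact: measurable_powR.
  by apply: (measurableT_comp (@measurable_expR R)).
- by move=> y _; rewrite lee_fin mulr_ge0 ?powR_ge0 ?expR_ge0.
- by rewrite lee_fin powR_ge0.
rewrite [RHS]EFinM; congr (_ * _).
have GE : \int[mu]_(y in `]0%R, +oo[) (y `^ (1 + g^-1 - 1) * expR (- y))%:E =
    \int[mu]_(y in `[0%R, +oo[) (y `^ g^-1 * expR (- y))%:E.
  have -> : (1 + g^-1 - 1 = g^-1)%R by rewrite addrAC subrr add0r.
  apply: integral_itv_obnd_cbnd.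
  apply: measurable_funTS; apply/measurable_EFinP; apply: measurable_funM.
    exact: measurable_powR.
  by apply: (measurableT_comp (@measurable_expR R)).
(* [Gamma] is a real-valued integral, equal to [0] by default if the integral is infinite;
   finiteness makes it the true value. *)
by rewrite /Gamma /Rintegral GE fineK// Gamma_integral_fin.
Qed.
End exponential_integrals.

(** * The law of the distances near zero *)

Lemma powR_continuous_at (R : realType) (a x : R) : 0 < x ->
  {for x, continuous (@powR R ^~ a)}.
Proof.
move=> x0; apply: differentiable_continuous; apply/derivable1_diffP.
by apply: derivable_powR; rewrite in_itv/= x0.
Qed.

Section law_near_zero.
Context (R : realType) (F : probability R R) (f : R -> R) (C alpha : R).
Hypotheses (F_supp : F `[0%R, +oo[%classic = 1%E) (F_density : is_density F f)
  (C_gt0 : 0 < C) (alpha_gt0 : 0 < alpha)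
  (f_at0 : f t / t `^ alpha @[t --> 0^'+] --> C).
Notation mu := (@lebesgue_measure R).

Let gamma := 1 + alpha.

Let gamma_gt0 : 0 < gamma. Proof. by rewrite addr_gt0. Qed.

Lemma density_atomless x : F [set x] = 0%E.
Proof. by have [_ _ ->//] := F_density; rewrite integral_set1. Qed.

Lemma density_measure_neg : F (~` `[0%R, +oo[%classic) = 0%E.
Proof. by rewrite probability_setC// F_supp subee. Qed.

Lemma density_measure_setI (A : set R) : measurable A ->
  F A = F (A `&` `[0%R, +oo[%classic).
Proof.
move=> mA; have m0 : measurable (`[0%R, +oo[%classic : set R) by [].
have mN : measurable (A `&` ~` `[0%R, +oo[%classic).
  by apply: measurableI => //; exact: measurableC.
have F0 : F (A `&` ~` `[0%R, +oo[%classic) = 0%E.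
  apply/eqP; rewrite -measure_le0 -density_measure_neg le_measure ?inE//.
  exact: measurableC.
rewrite -{1}(setIT A) -(setUv `[0%R, +oo[%classic) setIUr measureU//.
- by rewrite [X in (_ + X)%E](_ : _ = 0%E) ?adde0.
- exact: measurableI.
- by rewrite setIACA setICr setI0.
Qed.

Definition law_tail t : R := fine (F `]t, +oo[%classic).

Lemma tailE t : (F `]t, +oo[%classic = (law_tail t)%:E)%E.
Proof. by rewrite /law_tail fineK// fin_num_measure. Qed.

Lemma tail_ge0 t : 0 <= law_tail t. Proof. by rewrite fine_ge0. Qed.

Lemma tail_le1 t : law_tail t <= 1.
Proof. by rewrite -lee_fin -tailE probability_le1. Qed.

Lemma tail_noninc s t : s <= t -> law_tail t <= law_tail s.
Proof.
move=> st; rewrite -lee_fin -!tailE le_measure ?inE//.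
by apply: subset_itvr; rewrite bnd_simp.
Qed.

Definition law_head t : R := fine (F `]0, t]%classic).

Lemma headE t : (F `]0%R, t]%classic = (law_head t)%:E)%E.
Proof. by rewrite /law_head fineK// fin_num_measure. Qed.

Lemma tail_head t : 0 <= t -> law_tail t = 1 - law_head t.
Proof.
move=> t0; apply/eqP; rewrite eq_sym subr_eq; apply/eqP.
have : (F (`[0%R, +oo[%classic) =
    F [set 0%R] + (F `]0%R, t]%classic + F `]t, +oo[%classic))%E.
  rewrite -measureU//; last first.
    by rewrite -subset0 => x [] /=; rewrite !in_itv/= andbT => /andP[_ xt];
      move/(le_lt_trans xt); rewrite ltxx.
  rewrite -itv_bndbnd_setU ?bnd_simp// -measureU//; last first.
    by rewrite -subset0 => x [] /= ->; rewrite in_itv/= ltxx.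
  by rewrite setU1itv.
rewrite density_atomless add0e F_supp headE tailE -EFinD => -[->].
by rewrite addrC.
Qed.

Lemma integral_powR k t : 0 <= t ->
  (\int[mu]_(s in `]0%R, t]) (k * s `^ alpha)%:E = (k * (t `^ gamma / gamma))%:E)%E.
Proof.
rewrite le_eqVlt => /orP[/eqP <-|t0].
  by rewrite set_itvoc0 integral_set0 powR0 ?gt_eqF// mul0r mulr0.
pose G : R -> R := (k / gamma) \*: (@powR R ^~ gamma).
have cpow a : 0 < a -> {within `[0, t], continuous (@powR R ^~ a)}.
  move=> a0; apply/continuous_within_itvP => //; split.
  - by move=> x; rewrite in_itv/= => /andP[x0 _]; exact: powR_continuous_at.
  - by rewrite powR0 ?gt_eqF//; exact: powR_cvg0.
  - by apply: cvg_at_left_filter; exact: powR_continuous_at.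
have dG (x : R) : 0 < x -> is_derive x (1 : R) G (k * x `^ alpha).
  move=> x0; apply: (@is_derive_eq _ _ _ _ _ _ _
    ((k / gamma) *: (gamma * x `^ (gamma - 1)))).
    by apply: is_deriveZ; exact: is_derive1_powR.
  by rewrite /GRing.scale/= mulrA divfK ?gt_eqF// /gamma addrAC subrr add0r.
rewrite integral_itv_obnd_cbnd; last first.
  by apply: measurable_funTS; apply/measurable_EFinP; apply: measurable_funM.
rewrite (@continuous_FTC2 _ (fun s => k * s `^ alpha) G 0 t)//.
- by rewrite /G/= /GRing.scale/= powR0 ?gt_eqF// mulr0 sube0 -mulrA [gamma^-1 * _]mulrC.
- move=> x; apply: cvgM; [exact: cvg_cst|exact: (cpow _ alpha_gt0)].
- have /continuous_within_itvP[//|_ c0 c1] := cpow _ gamma_gt0; split.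
  + by move=> x; rewrite in_itv/= => /andP[/dG[]].
  + by apply: cvgM => //; exact: cvg_cst.
  + by apply: cvgM => //; exact: cvg_cst.
- by move=> x; rewrite in_itv/= => /andP[/dG[_ h] _]; rewrite derive1E.
Qed.

(** Near [0] the density lies between [C1] and [C3] times the power [alpha] of its argument;
    integration yields the power [gamma] divided by [gamma]. *)
Lemma head_bounds C1 C3 : 0 < C1 -> C1 < C -> C < C3 -> exists2 e, 0 < e &
  forall t, 0 <= t -> t < e ->
    C1 / gamma * t `^ gamma <= law_head t /\ law_head t <= C3 / gamma * t `^ gamma.
Proof.
move=> C10 C1C CC3; have [mf f0 fE] := F_density.
have : \forall s \near 0^'+, C1 * s `^ alpha <= f s <= C3 * s `^ alpha.
  near=> s; have s0 : 0 < s by near: s; exact: nbhs_right_gt.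
  have p0 : 0 < s `^ alpha by exact: powR_gt0.
  apply/andP; split.
    by rewrite -ler_pdivlMr//; near: s; exact: (cvgr_ge C f_at0).
  by rewrite -ler_pdivrMr//; near: s; exact: (cvgr_le C f_at0).
move=> [e /= e0 he]; exists e => // t t0 te.
have hs s : `]0, t]%classic s -> C1 * s `^ alpha <= f s <= C3 * s `^ alpha.
  rewrite /= in_itv/= => /andP[s0 st]; apply: he => //=.
  by rewrite sub0r normrN gtr0_norm//; exact: le_lt_trans te.
have mpow k : measurable_fun (`]0, t]%classic : set R) (fun s => (k * s `^ alpha)%:E).
  by apply: measurable_funTS; apply/measurable_EFinP; apply: measurable_funM.
have mfE : measurable_fun (`]0, t]%classic : set R) (EFin \o f).
  by apply: measurable_funTS; exact/measurable_EFinP.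
rewrite -!lee_fin -headE fE// -!mulrA ![gamma^-1 * _]mulrC.
rewrite -!integral_powR//; split; apply: ge0_le_integral => //.
- by move=> s _; rewrite lee_fin mulr_ge0 ?powR_ge0// ltW.
- exact: mpow.
- by move=> s /hs/andP[h _]; rewrite lee_fin.
- by move=> s _; rewrite lee_fin.
- exact: mpow.
- by move=> s /hs/andP[_ h]; rewrite lee_fin.
Unshelve. all: by end_near. Qed.

(** Since [expR y >= 1 + y], it suffices that [(1 - c3 x) (1 + c2 x) >= 1], and the bound on [x] is
    what makes the quadratic term smaller than the linear one. *)
Lemma one_sub_ge_expR (c2 c3 x : R) : 0 < c3 -> c3 < c2 -> 0 <= x ->
  x <= (c2 - c3) / (c2 * c3) -> expR (- (c2 * x)) <= 1 - c3 * x.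
Proof.
move=> c30 c32 x0; have c20 : 0 < c2 by exact: lt_trans c32.
rewrite ler_pdivlMr ?mulr_gt0// => hx.
have he := expR_ge1Dx (c2 * x); have e0 := expR_gt0 (c2 * x).
have c2x : 0 <= c2 * x by rewrite mulr_ge0// ltW.
rewrite expRN -div1r ler_pdivrMr//.
have h1 : 0 <= 1 - c3 * x.
  have : c3 * x * c2 <= c2 by nra.
  by rewrite -ler_pdivlMr// divff ?gt_eqF//; lra.
apply: (@le_trans _ _ ((1 - c3 * x) * (1 + c2 * x))).
  have : x * (x * (c2 * c3)) <= x * (c2 - c3) by rewrite ler_wpM2l.
  by nra.
by rewrite ler_wpM2l.
Qed.

(** The upper bound is [1 - x <= expR (- x)]. The reverse comparison holds only near [0] and with a
    loss in the constant, for which [c3] leaves room. *)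
Lemma tail_bounds (c1 c2 : R) : 0 < c1 -> c1 < C / gamma -> C / gamma < c2 ->
  exists2 e, 0 < e & forall t, 0 <= t -> t <= e ->
    expR (- (c2 * t `^ gamma)) <= law_tail t /\ law_tail t <= expR (- (c1 * t `^ gamma)).
Proof.
move=> c10 c1c cc2; pose c3 := (C / gamma + c2) / 2.
have cc3 : C / gamma < c3 by rewrite /c3; lra.
have c32 : c3 < c2 by rewrite /c3; lra.
have c30 : 0 < c3 by apply: lt_trans cc3; rewrite divr_gt0.
have [//| | |e e0 he] := @head_bounds (c1 * gamma) (c3 * gamma).
- exact: mulr_gt0.
- by rewrite -ltr_pdivlMr.
- by rewrite -ltr_pdivrMr.
pose x0 := (c2 - c3) / (c2 * c3).
have x00 : 0 < x0.
  by rewrite divr_gt0 ?subr_gt0// mulr_gt0//; exact: lt_trans c32.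
(* [e / 2] keeps [t] strictly below [e], [1] ensures that the power [gamma] of [t] is at most [t],
   and [x0] is the range of the exponential comparison. *)
pose e' := Num.min (e / 2) (Num.min 1 x0).
exists e'; first by rewrite !lt_min divr_gt0//= ltr01 x00.
move=> t t0; rewrite !le_min => /and3P[te t1 tx].
have te' : t < e by apply: (le_lt_trans te); rewrite ltr_pdivrMr// ltr_pMr// ltr1n.
have tg : t `^ gamma <= t.
  have [->|tN0] := eqVneq t 0; first by rewrite powR0// gt_eqF.
  by apply: ge1r_powR; rewrite ?lt0r ?tN0 ?t0// /gamma lerDl ltW.
have [] := he t t0 te'; rewrite !mulfK ?gt_eqF// => h1 h2.
rewrite tail_head//; split.
  apply: (@le_trans _ _ (1 - c3 * t `^ gamma)); last by rewrite lerB.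
  by apply: one_sub_ge_expR => //; [exact: powR_ge0|exact: le_trans tx].
apply: (le_trans _ (expR_ge1Dx _)); rewrite lerD2l lerN2//.
Qed.
End law_near_zero.

(** * Moments of a minimum estimated through the tail *)

Section min_moment_bounds.
Context (R : realType) (F : probability R R).
Hypothesis F_supp : F `[0%R, +oo[%classic = 1%E.
Notation mu := (@lebesgue_measure R).
Local Notation tail := (law_tail F).

(** An even power also lets in negative [y]; the support of [F] removes them. *)
Lemma measure_exprn_gt_tail k (t : R) : (0 < k)%N -> 0 <= t ->
  F [set y | t < y ^+ k] = (tail (t `^ k%:R^-1))%:E.
Proof.
move=> k0 t0; rewrite -tailE (density_measure_setI F_supp); last exact: measurable_exprn_gt.
rewrite [RHS](density_measure_setI F_supp)//; congr (F _).
have h (y : R) : 0 <= y -> (t < y ^+ k) = (t `^ k%:R^-1 < y).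
  move=> y0; rewrite !ltNge -powR_mulrn//; congr (~~ _).
  by rewrite powR_ler_inv// ltr0n.
by apply/seteqP; split=> y /=; rewrite !in_itv/= !andbT => -[h1 y0];
  split=> //; move: h1; rewrite h.
Qed.

Lemma measurable_tail_powR k m :
  measurable_fun setT (fun t : R => (tail (t `^ k%:R^-1) ^+ m)%:E).
Proof.
apply/measurable_EFinP; apply: measurable_funX.
apply: (@measurableT_comp _ _ _ _ _ _ tail); last exact: measurable_powR.
by apply: nonincreasing_measurable => // s t st; exact: tail_noninc.
Qed.

Lemma min_momentE k m : (0 < k)%N -> min_moment F k m =
  (\int[mu]_(t in `[0%R, +oo[) (tail (t `^ k%:R^-1) ^+ m)%:E)%E.
Proof.
move=> k0; apply: eq_integral => t; rewrite inE/= in_itv/= andbT => t0.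
by rewrite measure_exprn_gt_tail// EFin_expe.
Qed.

Lemma min_moment_ge0 k m : (0 <= min_moment F k m)%E.
Proof. by apply: integral_ge0 => t _; exact: expe_ge0. Qed.

Section near_zero.
Variables (g c e : R).
Hypotheses (g_gt1 : 1 < g) (c_gt0 : 0 < c) (e_gt0 : 0 < e).

Let r := expR (- (c * e `^ g)).

Let measurable_stretched (c' g' : R) :
  measurable_fun setT (fun t : R => (expR (- (c' * t `^ g')))%:E).
Proof.
apply/measurable_EFinP; apply: (measurableT_comp (@measurable_expR R)).
apply: measurableT_comp => //; apply: measurable_funM => //.
Qed.

(** Up to [e] the exponential bound applies to all [m.+1] factors. Beyond [e], [m] factors are at
    most [r] and the last one is kept as it is, to remain integrable. *)
Lemma min_moment_upper k m : (0 < k <= 2)%N ->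
  (forall t, 0 <= t -> t <= e -> tail t <= expR (- (c * t `^ g))) ->
  (min_moment F k m.+1 <=
    ((m.+1%:R * c) `^ (- (k%:R / g)) * Gamma (1 + k%:R / g))%:E +
    (r ^+ m)%:E * min_moment F k 1)%E.
Proof.
move=> /andP[k0 k2] te; have g0 : 0 < g by exact: lt_trans g_gt1.
have kR0 : (0 : R) < k%:R by rewrite ltr0n.
(* The tail is evaluated at the [k]-th root of [t], which divides the exponent by [k]. *)
pose G := g / k%:R.
have G2 : 2^-1 <= G.
  rewrite /G ler_pdivlMr//; have : (k%:R : R) <= 2 by rewrite (ler_nat _ k 2).
  by move: g_gt1; lra.
have -> : k%:R / g = G^-1 by rewrite /G invf_div.
rewrite -stretched_exponential_integral ?mulr_gt0 ?ltr0n//.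
rewrite !min_momentE// -ge0_integralZl//; last 3 first.
- by apply: measurable_funTS; exact: measurable_tail_powR.
- by move=> t _; rewrite lee_fin exprn_ge0// tail_ge0.
- by rewrite lee_fin exprn_ge0// expR_ge0.
rewrite -ge0_integralD//; last 3 first.
- by apply: measurable_funTS; exact: measurable_stretched.
- by move=> t _; rewrite -EFinM lee_fin mulr_ge0// exprn_ge0 ?expR_ge0 ?tail_ge0.
- by apply: measurable_funTS; apply: emeasurable_funM => //; exact: measurable_tail_powR.
apply: ge0_le_integral => //.
- by move=> t _; rewrite lee_fin exprn_ge0// tail_ge0.
- by apply: measurable_funTS; exact: measurable_tail_powR.
- apply: measurable_funTS; apply: emeasurable_funD; first exact: measurable_stretched.
  by apply: emeasurable_funM => //; exact: measurable_tail_powR.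
move=> t; rewrite /= in_itv/= andbT => t0.
rewrite -EFinM -EFinD lee_fin expr1; set s := t `^ k%:R^-1.
have s0 : 0 <= s by exact: powR_ge0.
have tG : t `^ G = s `^ g by rewrite /s -powRrM /G mulrC.
have [se|es] := leP s e.
  apply: (@le_trans _ _ (expR (- (c * s `^ g)) ^+ m.+1)).
    by apply: lerXn2r; rewrite ?nnegrE ?tail_ge0 ?expR_ge0//; exact: te.
  rewrite -expRM_natl tG mulrN mulrA lerDl mulr_ge0 ?tail_ge0// exprn_ge0//.
  exact: expR_ge0.
apply: (@le_trans _ _ (r ^+ m * tail s)); last by rewrite lerDr expR_ge0.
rewrite exprSr ler_wpM2r ?tail_ge0//; apply: lerXn2r.
- by rewrite nnegrE tail_ge0.
- by rewrite nnegrE expR_ge0.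
- apply: (le_trans (tail_noninc _ (ltW es))).
  by apply: te => //; exact: ltW.
Qed.

(** The exponential bound fails beyond [e], but there the exponential itself is small: [m] of its
    factors are at most [r], and the last one is integrable. *)
Lemma min_moment_lower m :
  (forall t, 0 <= t -> t <= e -> expR (- (c * t `^ g)) <= tail t) ->
  (((m.+1%:R * c) `^ (- g^-1) * Gamma (1 + g^-1))%:E <=
    min_moment F 1 m.+1 + (r ^+ m * (c `^ (- g^-1) * Gamma (1 + g^-1)))%:E)%E.
Proof.
move=> te; have g0 : 0 < g by exact: lt_trans g_gt1.
have g2 : 2^-1 <= g by move: g_gt1; lra.
rewrite [(r ^+ m * _)%:E]EFinM -!stretched_exponential_integral ?mulr_gt0 ?ltr0n//.
rewrite min_momentE// -ge0_integralZl//; last 2 first.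
- by apply: measurable_funTS; exact: measurable_stretched.
- by rewrite lee_fin exprn_ge0// expR_ge0.
rewrite -ge0_integralD//; last 4 first.
- by move=> t _; rewrite lee_fin exprn_ge0// tail_ge0.
- by apply: measurable_funTS; exact: measurable_tail_powR.
- by move=> t _; rewrite -EFinM lee_fin mulr_ge0// ?exprn_ge0 ?expR_ge0.
- by apply: measurable_funTS; apply: emeasurable_funM => //; exact: measurable_stretched.
apply: ge0_le_integral => //.
- by apply: measurable_funTS; exact: measurable_stretched.
- apply: measurable_funTS; apply: emeasurable_funD; first exact: measurable_tail_powR.
  by apply: emeasurable_funM => //; exact: measurable_stretched.
move=> t; rewrite /= in_itv/= andbT => t0.
rewrite -EFinM -EFinD lee_fin invr1 powRr1//.
have -> : expR (- (m.+1%:R * c * t `^ g)) = expR (- (c * t `^ g)) ^+ m.+1.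
  by rewrite -expRM_natl mulrN mulrA.
have [se|es] := leP t e.
  rewrite ler_wpDr ?mulr_ge0 ?exprn_ge0 ?expR_ge0//.
  by apply: lerXn2r; rewrite ?nnegrE ?tail_ge0 ?expR_ge0//; exact: te.
rewrite ler_wpDl ?exprn_ge0 ?tail_ge0// exprSr ler_wpM2r ?expR_ge0//.
apply: lerXn2r; rewrite ?nnegrE ?expR_ge0// /r ler_expR lerN2 ler_wpM2l ?(ltW c_gt0)//.
by apply: ge0_ler_powR; rewrite ?nnegrE ?(ltW e_gt0)// ltW.
Qed.
End near_zero.

Lemma min_moment1_le k : (0 < k)%N ->
  (min_moment F k 1 <= \int[F]_y (`|y| ^+ k)%:E)%E.
Proof.
move=> k0.
have mX : measurable_fun setT (fun y : R => `|y| ^+ k).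
  by apply: measurable_funX; exact: normr_measurable.
pose X : {RV F >-> R} := HB.pack (fun y : R => `|y| ^+ k)
  (isMeasurableFun.Build _ _ _ _ _ mX).
have X0 y : 0 <= X y by rewrite exprn_ge0.
have := ge0_expectation_ccdf X0; rewrite expectation_def => ->.
apply: ge0_le_integral => //.
- apply: (@eq_measurable_fun _ _ _ _ _ (fun t => (tail (t `^ k%:R^-1) ^+ 1)%:E)).
    move=> t; rewrite inE/= in_itv/= andbT => t0.
    by rewrite measure_exprn_gt_tail// EFin_expe.
  by apply: measurable_funTS; exact: measurable_tail_powR.
- by apply: measurable_funTS; exact: ccdf_measurable.
move=> t _; apply: (@le_trans _ _ (F [set y | t < y ^+ k])) => //.
rewrite le_measure ?inE//.
- exact: measurable_exprn_gt.
- by have := mX measurableT `]t, +oo[%classic; rewrite setTI; exact.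
- move=> y /= ty; rewrite in_itv/= andbT; apply: (lt_le_trans ty).
  by rewrite -normrX ler_norm.
Qed.

Lemma expectation_sqr_fin : F.-integrable [set: R] (fun t => t%:E) ->
  ('V_F[fun t : R => t] < +oo)%E -> (\int[F]_y (`|y| ^+ 2)%:E < +oo)%E.
Proof.
move=> iF vF; set m := fine ('E_F[fun t : R => t])%E.
have v1 : (\int[F]_y ((y - m) ^+ 2)%:E < +oo)%E.
  apply: le_lt_trans vF; rewrite /variance covariance.unlock /m expectation.unlock.
  by under eq_integral do rewrite expr2.
have nX : nonneg_mfun (fun y : R => `|y| ^+ 2).
  by apply: nonneg_mfunX; split=> //; exact: normr_measurable.
have nY : nonneg_mfun (fun y : R => (y - m) ^+ 2).
  by split=> [|y]; [exact/measurable_funX/measurable_funB|rewrite sqr_ge0].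
have nY2 : nonneg_mfun (fun y : R => 2 * (y - m) ^+ 2).
  by apply: nonneg_mfunM => //; exact: nonneg_mfun_cst.
have nm : nonneg_mfun (fun _ : R => 2 * m ^+ 2).
  by apply: nonneg_mfun_cst; rewrite mulr_ge0// sqr_ge0.
apply: (le_lt_trans (le_Ex F nX (nonneg_mfunD nY2 nm) _)).
  (* The bound is [y^2 <= 2 (y - m)^2 + 2 m^2], with slack [(y - 2 m)^2]. *)
  by move=> y; rewrite real_normK ?num_real//; have := sqr_ge0 (y - 2 * m); nra.
rewrite ExD// ExZl// integral_cst//= probability_setT mule1.
by rewrite lte_add_pinfty ?ltry// lte_mul_pinfty.
Qed.

Lemma min_moment_fin : F.-integrable [set: R] (fun t => t%:E) ->
  ('V_F[fun t : R => t] < +oo)%E -> forall k m, (0 < k <= 2)%N ->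
  min_moment F k m.+1 \is a fin_num.
Proof.
move=> iF vF k m /andP[k0 k2]; rewrite ge0_fin_numE; last exact: min_moment_ge0.
apply: (@le_lt_trans _ _ (min_moment F k 1)).
  rewrite !min_momentE//; apply: ge0_le_integral => //.
  - by move=> t _; rewrite lee_fin exprn_ge0 ?tail_ge0.
  - by apply: measurable_funTS; exact: measurable_tail_powR.
  - by apply: measurable_funTS; exact: measurable_tail_powR.
  - move=> t _; rewrite lee_fin exprS expr1 ler_piMr ?tail_ge0//.
    by apply: exprn_ile1; rewrite ?tail_ge0 ?tail_le1.
apply: (le_lt_trans (min_moment1_le k0)).
case: k k0 k2 => [|[|[|//]]] // _ _; last exact: expectation_sqr_fin.
move/integrableP : iF => [_]; apply: le_lt_trans.
by rewrite le_eqVlt; apply/orP; left; apply/eqP; apply: eq_integral => y _.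
Qed.
End min_moment_bounds.

(** * Asymptotics of the moments of minima *)

Lemma powR_expRN_cvg0 (R : realType) (p k : R) : p <= 2 -> 0 < k ->
  m.+1%:R `^ p * expR (- k) ^+ m @[m --> \oo] --> (0 : R).
Proof.
(* With [x = m + 1], the bounds [x^p <= x^2] and [exp (k x) >= (k x)^3 / 6] leave [K / x]. *)
move=> p2 k0; pose K := 6 * expR k / k ^+ 3.
have K0 : 0 < K by rewrite divr_gt0 ?mulr_gt0 ?expR_gt0 ?exprn_gt0.
apply: (@squeeze_cvgr _ _ _ _ (fun=> 0) (fun m => K * m.+1%:R^-1)).
- near=> m; rewrite mulr_ge0 ?powR_ge0 ?exprn_ge0 ?expR_ge0//=.
  pose x : R := m.+1%:R; have x1 : 1 <= x by rewrite ler1n.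
  have x0 : 0 < x by exact: lt_le_trans x1.
  have xp : x `^ p <= x ^+ 2 by rewrite -powR_mulrn ?(ltW x0)//; exact: ler_powR.
  have -> : expR (- k) ^+ m = expR k / expR (k * x).
    rewrite -expRM_natl -expRN -expRD; congr expR; rewrite /x -natr1; ring.
  have he := expR_ge1Dxn 2 (ltW (mulr_gt0 k0 x0)).
  have he' : (k * x) ^+ 3 / 6 <= expR (k * x).
    apply: le_trans he; rewrite (_ : 3`!%:R = 6 :> R)//; lra.
  apply: (@le_trans _ _ (x ^+ 2 * (expR k / ((k * x) ^+ 3 / 6)))).
    have q0 : 0 <= expR k / expR (k * x) by rewrite divr_ge0 ?expR_ge0.
    apply: (ler_pM (powR_ge0 _ _) q0 xp).
    rewrite ler_wpM2l ?expR_ge0// lef_pV2 ?posrE ?expR_gt0//.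
    by rewrite divr_gt0// exprn_gt0// mulr_gt0.
  rewrite le_eqVlt; apply/orP; left; apply/eqP; rewrite /K -/x; field.
  by rewrite !gt_eqF.
- exact: cvg_cst.
- rewrite -[X in _ --> X](mulr0 K); apply: cvgM; first exact: cvg_cst.
  exact: cvg_harmonic.
Unshelve. all: by end_near. Qed.

Section min_moment_asymptotics.
Context (R : realType) (F : probability R R) (f : R -> R) (C alpha : R).
Hypotheses (F_supp : F `[0%R, +oo[%classic = 1%E)
  (F_mean : F.-integrable [set: R] (fun t => t%:E))
  (F_var : ('V_F[fun t : R => t] < +oo)%E)
  (F_density : is_density F f)
  (C_gt0 : 0 < C) (alpha_gt0 : 0 < alpha)
  (f_at0 : f t / t `^ alpha @[t --> 0^'+] --> C).

Let g := 1 + alpha.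
Let b := g^-1.
Let c := C / g.
Let K := c `^ (- b) * Gamma (1 + b).
Let mom k m := fine (min_moment F k m).

Let g_gt1 : 1 < g. Proof. by rewrite ltrDl. Qed.
Let g_gt0 : 0 < g. Proof. exact: lt_trans g_gt1. Qed.
Let c_gt0 : 0 < c. Proof. exact: divr_gt0. Qed.
Let b_lt1 : b < 1. Proof. by rewrite invf_lt1. Qed.

Let momE k m : (0 < k <= 2)%N -> min_moment F k m.+1 = (mom k m.+1)%:E.
Proof. by move=> k02; rewrite fineK//; exact: min_moment_fin. Qed.

Let mom_ge0 k m : 0 <= mom k m.
Proof. by rewrite fine_ge0// min_moment_ge0. Qed.

Let powR_cancel (m : nat) (a p : R) : 0 < a ->
  m.+1%:R `^ p * (m.+1%:R * a) `^ (- p) = a `^ (- p).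
Proof.
move=> a0; rewrite powRM ?(ltW a0)// mulrA -powRD; last first.
  by rewrite pnatr_eq0 implybT.
by rewrite subrr powRr0 mul1r.
Qed.

Lemma mom1_upper c1 : 0 < c1 -> c1 < c -> exists2 k, 0 < k &
  forall m, m.+1%:R `^ b * mom 1 m.+1 <=
    c1 `^ (- b) * Gamma (1 + b) + (m.+1%:R `^ b * expR (- k) ^+ m) * mom 1 1.
Proof.
move=> c10 c1c.
(* Only the upper half of the tail bounds is used, so any constant above [c] serves as the other
   one. *)
have cc1 : c < c + 1 by rewrite ltrDl.
have [e e0 he] := tail_bounds F_supp F_density C_gt0 alpha_gt0 f_at0 c10 c1c cc1.
exists (c1 * e `^ g); first by rewrite mulr_gt0// powR_gt0.
move=> m; have := @min_moment_upper _ _ F_supp g c1 e g_gt1 c10 e0 1 m isT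
  (fun t t0 te => (he t t0 te).2).
rewrite !momE// -EFinM -EFinD lee_fin mul1r -/b => h.
by rewrite -(@powR_cancel m c1 b c10) -!mulrA -mulrDr ler_wpM2l ?powR_ge0//.
Qed.

Lemma mom1_lower c2 : c < c2 -> exists2 k, 0 < k &
  forall m, c2 `^ (- b) * Gamma (1 + b) -
    (m.+1%:R `^ b * expR (- k) ^+ m) * (c2 `^ (- b) * Gamma (1 + b)) <=
    m.+1%:R `^ b * mom 1 m.+1.
Proof.
move=> cc2; have c20 : 0 < c2 by exact: lt_trans cc2.
have c20' : 0 < c / 2 by rewrite divr_gt0.
have c2c : c / 2 < c by rewrite ltr_pdivrMr// ltr_pMr// ltr1n.
have [e e0 he] := tail_bounds F_supp F_density C_gt0 alpha_gt0 f_at0 c20' c2c cc2.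
exists (c2 * e `^ g); first by rewrite mulr_gt0// powR_gt0.
move=> m; have := @min_moment_lower _ _ F_supp g c2 e g_gt1 c20 e0 m
  (fun t t0 te => (he t t0 te).1).
rewrite !momE// -EFinD lee_fin -/b => h.
by rewrite lerBlDr -{1}(@powR_cancel m c2 b c20) -!mulrA -mulrDr ler_wpM2l ?powR_ge0//.
Qed.

(** The upper and lower bounds hold with constants arbitrarily close to [c]; the limit follows by
    continuity of their main term at [c], the remainders being exponentially small. *)
Lemma mom1_cvg : m.+1%:R `^ b * mom 1 m.+1 @[m --> \oo] --> K.
Proof.
apply/cvgrPdist_le => e e0.
have cK : (fun x : R => x `^ (- b) * Gamma (1 + b)) x @[x --> c] --> K.
  apply: cvgM; last exact: cvg_cst.
  exact: (@powR_continuous_at _ (- b) c c_gt0).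
have e20 : 0 < e / 2 by rewrite divr_gt0.
move/cvgrPdist_le : cK => /(_ _ e20)[d /= d0 hd].
(* [c - h] stays positive, and [c - h] and [c + h] lie within the continuity radius [d]. *)
pose h := Num.min (d / 2) (c / 2).
have h0 : 0 < h by rewrite lt_min !divr_gt0.
have hc : h <= c / 2 by rewrite ge_min lexx orbT.
have hd2 : h < d.
  rewrite (@le_lt_trans _ _ (d / 2)) ?ge_min ?lexx//.
  by rewrite ltr_pdivrMr// ltr_pMr// ltr1n.
have [||k k0 hu] := @mom1_upper (c - h).
- by have := c_gt0; lra.
- by rewrite gtrBl.
have [|k' k'0 hl] := @mom1_lower (c + h); first by rewrite ltrDl.
have b2 : b <= 2 by have := b_lt1; lra.
have u0 : (m.+1%:R `^ b * expR (- k) ^+ m) * mom 1 1 @[m --> \oo] --> (0 : R).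
  rewrite -[X in _ --> X](mul0r (mom 1 1)); apply: cvgM; last exact: cvg_cst.
  exact: powR_expRN_cvg0.
have l0 : (m.+1%:R `^ b * expR (- k') ^+ m) * ((c + h) `^ (- b) * Gamma (1 + b))
    @[m --> \oo] --> (0 : R).
  rewrite -[X in _ --> X](mul0r ((c + h) `^ (- b) * Gamma (1 + b))).
  apply: cvgM; last exact: cvg_cst.
  exact: powR_expRN_cvg0.
have hc1 : `|K - (c - h) `^ (- b) * Gamma (1 + b)| <= e / 2.
  by apply: hd; rewrite /ball_ /= opprB addrC subrK gtr0_norm.
have hc2 : `|K - (c + h) `^ (- b) * Gamma (1 + b)| <= e / 2.
  by apply: hd; rewrite /ball_ /= opprD addrA subrr sub0r normrN gtr0_norm.
move/cvgrPdist_le : u0 => /(_ _ e20) u0; move/cvgrPdist_le : l0 => /(_ _ e20) l0.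
near=> m.
have : `|0 - (m.+1%:R `^ b * expR (- k) ^+ m) * mom 1 1| <= e / 2 by near: m.
have : `|0 - (m.+1%:R `^ b * expR (- k') ^+ m) *
    ((c + h) `^ (- b) * Gamma (1 + b))| <= e / 2.
  by near: m.
move: (hu m) (hl m) hc1 hc2; rewrite !ler_norml !sub0r.
set x := _ * mom 1 m.+1; set y1 := (c - h) `^ _ * _; set y2 := (c + h) `^ _ * _.
set z1 := _ * mom 1 1; set z2 := _ * y2.
move=> h1 h2 /andP[h3 h4] /andP[h5 h6] /andP[h7 h8] /andP[h9 h10].
by apply/andP; split; lra.
Unshelve. all: by end_near. Qed.

(** The second moment is of order at most [m^(- 2 b)], so a crude constant such as [c / 2] leaves
    [O (1 / m)]. The weight is the one that summation against [n^(2 - 2 b)] requires. *)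
Lemma mom2_cvg : m.+1%:R `^ (2 * b - 1) * mom 2 m.+1 @[m --> \oo] --> (0 : R).
Proof.
have c20 : 0 < c / 2 by rewrite divr_gt0.
have c2c : c / 2 < c by rewrite ltr_pdivrMr// ltr_pMr// ltr1n.
have cc1 : c < c + 1 by rewrite ltrDl.
have [e e0 he] := tail_bounds F_supp F_density C_gt0 alpha_gt0 f_at0 c20 c2c cc1.
pose k := (c / 2) * e `^ g; have k0 : 0 < k by rewrite mulr_gt0// powR_gt0.
pose A := (c / 2) `^ (- (2 * b)) * Gamma (1 + 2 * b).
apply: (@squeeze_cvgr _ _ _ _ (fun=> 0)
  (fun m => m.+1%:R^-1 * A + (m.+1%:R `^ (2 * b - 1) * expR (- k) ^+ m) * mom 2 1)).
- near=> m; rewrite mulr_ge0 ?powR_ge0//=.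
  have := @min_moment_upper _ _ F_supp g (c / 2) e g_gt1 c20 e0 2 m isT
    (fun t t0 te => (he t t0 te).2).
  rewrite !momE// -EFinM -EFinD lee_fin -/b => h.
  have m0 : (m.+1%:R : R) != 0 by rewrite pnatr_eq0.
  have -> : m.+1%:R^-1 * A = m.+1%:R `^ (2 * b - 1) *
      ((m.+1%:R * (c / 2)) `^ (- (2 * b)) * Gamma (1 + 2 * b)).
    rewrite /A -(@powR_cancel m (c / 2) (2 * b) c20) powRD; last by rewrite m0 implybT.
    by rewrite powR_inv1 ?ler0n//; ring.
  by rewrite -[X in _ <= _ + X]mulrA -mulrDr ler_wpM2l ?powR_ge0.
- exact: cvg_cst.
- rewrite -[X in _ --> X](addr0 (0 : R)); apply: cvgD.
    rewrite -[X in _ --> X](mul0r A); apply: cvgM; last exact: cvg_cst.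
    exact: cvg_harmonic.
  rewrite -[X in _ --> X](mul0r (mom 2 1)); apply: cvgM; last exact: cvg_cst.
  by apply: powR_expRN_cvg0 => //; have := b_lt1; lra.
Unshelve. all: by end_near. Qed.
End min_moment_asymptotics.

(** * Summation of sequences equivalent to a power *)

Section weighted_cesaro.
Context (R : realType) (p : R).
Hypothesis p_gt0 : 0 < p.

Lemma powRV_ge0 (x q : R) : 0 <= x -> x^-1 `^ q = (x `^ q)^-1.
Proof. by move=> x0; rewrite -powR_inv1// -powRrM mulN1r powRN. Qed.

Lemma one_sub_invSn n : 1 - n.+1%:R^-1 = n%:R / n.+1%:R :> R.
Proof.
have n0 : (n.+1%:R : R) != 0 by rewrite pnatr_eq0.
by apply: (mulIf n0); rewrite mulrBl mulVf// divfK// mul1r -natr1 addrK.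
Qed.

(** With [h = - 1 / (k + 1)], the expression is the difference quotient at [1] of the power
    function, whose derivative there is [p]. *)
Lemma powR_increment_cvg :
  k.+1%:R `^ (1 - p) * (k.+1%:R `^ p - k%:R `^ p) @[k --> \oo] --> p.
Proof.
have [dv dE] := @is_derive1_powR R p 1 ltr01.
rewrite powR1 mulr1 in dE.
have D : h^-1 *: ((h + 1) `^ p - 1 `^ p) @[h --> 0^'] --> p.
  rewrite -[X in _ --> X]dE; move: dv; rewrite /derivable /derive.
  rewrite (_ : (fun h : R => _) = (fun h => h^-1 *: ((h + 1) `^ p - 1 `^ p)))//.
  by apply/funext => h; rewrite /shift/= /GRing.scale/= mulr1.
have H : (forall k, - (k.+1%:R^-1 : R) != 0) /\
    - (k.+1%:R^-1 : R) @[k --> \oo] --> (0 : R).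
  split=> [k|]; first by rewrite oppr_eq0 invr_eq0 pnatr_eq0.
  by rewrite -[X in _ --> X]oppr0; apply: cvgN; exact: cvg_harmonic.
move/cvgr_dnbhsP : D => /(_ _ H); apply: cvg_trans; apply: near_eq_cvg; near=> k.
have k0 : (k.+1%:R : R) != 0 by rewrite pnatr_eq0.
have -> : - (k.+1%:R^-1) + 1 = k%:R / k.+1%:R :> R.
  by rewrite addrC one_sub_invSn.
rewrite powR1 /GRing.scale/= powRM ?invr_ge0// powRV_ge0//.
rewrite powRB; last by rewrite k0 implybT.
rewrite powRr1//; field.
by rewrite nat1r k0 gt_eqF// powR_gt0.
Unshelve. all: by end_near. Qed.

Lemma natr_powRN_cvg0 : (n.+1%:R `^ p)^-1 @[n --> \oo] --> (0 : R).
Proof.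
have /cvg_at_rightP := powR_cvg0 p_gt0.
move=> /(_ (fun n => n.+1%:R^-1)) h.
rewrite (_ : (fun n => _) = (fun n : nat => n.+1%:R^-1 `^ p)).
  by apply: h; split=> [n|]; [rewrite invr_gt0|exact: cvg_harmonic].
by apply/funext => n; rewrite powRV_ge0.
Qed.

Lemma natr_powR_ratio_cvg : n%:R `^ p / n.+1%:R `^ p @[n --> \oo] --> (1 : R).
Proof.
rewrite (_ : (fun n => _) = (fun n : nat => (1 - n.+1%:R^-1) `^ p)); last first.
  apply/funext => n.
  by rewrite one_sub_invSn powRM ?invr_ge0// powRV_ge0.
rewrite [X in _ --> X](_ : 1 = (1 : R) `^ p); last by rewrite powR1.
have h : (1 - n.+1%:R^-1 : R) @[n --> \oo] --> (1 : R).
  rewrite -[X in _ --> X](subr0 (1 : R)); apply: cvgB; first exact: cvg_cst.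
  exact: cvg_harmonic.
exact: (@continuous_cvg _ _ _ _ _ _ (@powR R ^~ p) _ (powR_continuous_at ltr01) h).
Qed.

(* Compare [u k.+1] with the increment of [k `^ p], which is equivalent to
   [p k `^ (p - 1)] and telescopes. *)
Lemma weighted_cesaro (u : nat -> R) (L : R) :
  k.+1%:R `^ (1 - p) * u k.+1 @[k --> \oo] --> L ->
  (\sum_(1 <= k < n.+1) u k) / n.+1%:R `^ p @[n --> \oo] --> L / p.
Proof.
move=> uL; pose M := L / p.
pose c (k : nat) : R := k.+1%:R `^ p - k%:R `^ p.
have c0 k : 0 <= c k.
  by rewrite subr_ge0; apply: ge0_ler_powR; rewrite ?nnegrE ?ler0n ?ler_nat ?(ltW p_gt0).
have sc n : \sum_(0 <= k < n) c k = n%:R `^ p.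
  elim: n => [|n IHn]; first by rewrite big_geq// powR0 ?gt_eqF.
  by rewrite big_nat_recr//= IHn /c addrC subrK.
pose w k := u k.+1 - M * c k.
have w0 : k.+1%:R `^ (1 - p) * w k @[k --> \oo] --> (0 : R).
  rewrite (_ : (fun k => _) = (fun k => k.+1%:R `^ (1 - p) * u k.+1 -
    M * (k.+1%:R `^ (1 - p) * c k))); last by apply/funext => k; rewrite /w; ring.
  have -> : 0 = L - M * p by rewrite /M divfK ?subrr// gt_eqF.
  by apply: cvgB => //; apply: cvgM; [exact: cvg_cst|exact: powR_increment_cvg].
have sw n : \sum_(1 <= k < n.+1) u k = M * n%:R `^ p + \sum_(0 <= k < n) w k.
  rewrite big_add1/= -sc mulr_sumr -big_split/=.
  by apply: eq_bigr => k _; rewrite /w addrC subrK.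
have W0 : (\sum_(0 <= k < n) w k) / n.+1%:R `^ p @[n --> \oo] --> (0 : R).
  apply/cvgrPdist_le => e e0.
  (* The weighted increment is eventually at least [p / 2]; bounding the weighted [w k] by
     [e / 2 * (p / 2)] therefore gives a bound by [e / 2 * c k], which telescopes. *)
  have e40 : 0 < e / 2 * (p / 2) by rewrite mulr_gt0// divr_gt0.
  have [N _ hN] : \forall k \near \oo, `|w k| <= e / 2 * c k.
    have p2 : p / 2 < p by rewrite ltr_pdivrMr// ltr_pMr// ltr1n.
    have h1 : \forall k \near \oo, p / 2 <= k.+1%:R `^ (1 - p) * c k.
      exact: (cvgr_ge _ powR_increment_cvg).
    move/cvgrPdist_le : w0 => /(_ _ e40) h2.
    near=> k.
    have h1k : p / 2 <= k.+1%:R `^ (1 - p) * c k by near: k.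
    have : `|0 - k.+1%:R `^ (1 - p) * w k| <= e / 2 * (p / 2) by near: k.
    have q0 : 0 < (k.+1%:R : R) `^ (1 - p) by exact: powR_gt0.
    rewrite sub0r normrN normrM (gtr0_norm q0) => h.
    rewrite -(ler_pM2l q0); apply: (le_trans h).
    by rewrite [leRHS]mulrCA ler_wpM2l// ltW// divr_gt0.
  pose B := \sum_(0 <= k < N) `|w k|.
  have B0 : 0 <= B by apply: sumr_ge0.
  have h3 : B * (n.+1%:R `^ p)^-1 @[n --> \oo] --> (0 : R).
    rewrite -[X in _ --> X](mulr0 B); apply: cvgM; first exact: cvg_cst.
    exact: natr_powRN_cvg0.
  have e20 : 0 < e / 2 by rewrite divr_gt0.
  move/cvgrPdist_le : h3 => /(_ _ e20) h3.
  near=> n.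
  have Nn : (N <= n)%N by near: n; exact: nbhs_infty_ge.
  have : `|0 - B * (n.+1%:R `^ p)^-1| <= e / 2 by near: n.
  have q0 : 0 < (n.+1%:R : R) `^ p by exact: powR_gt0.
  rewrite !sub0r !normrN ger0_norm; last by rewrite mulr_ge0// invr_ge0 ltW.
  move=> hB; rewrite normrM [`|_^-1|]gtr0_norm ?invr_gt0//.
  have hs : `|\sum_(0 <= k < n) w k| <= B + e / 2 * n.+1%:R `^ p.
    apply: (le_trans (ler_norm_sum _ _ _)).
    rewrite (@big_cat_nat _ _ _ N)//= lerD2l.
    apply: (@le_trans _ _ (\sum_(N <= k < n) e / 2 * c k)).
      rewrite !big_nat; apply: ler_sum => k /andP[Nk _]; exact: hN.
    rewrite -mulr_sumr ler_wpM2l ?(ltW e20)//.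
    apply: (@le_trans _ _ (n%:R `^ p)).
      by rewrite -sc [leRHS](@big_cat_nat _ _ _ N)//= ler_wpDl// sumr_ge0.
    by apply: ge0_ler_powR; rewrite ?nnegrE ?ler0n ?ler_nat ?(ltW p_gt0).
  rewrite ler_pdivrMr//; apply: (le_trans hs).
  have : B <= e / 2 * n.+1%:R `^ p by rewrite -ler_pdivrMr.
  by move=> hB'; rewrite [e in leRHS]splitr mulrDl lerD2r.
(* The increments telescope to a power of [n], while the normalization uses [n.+1]; the ratio tends
   to [1]. *)
rewrite (_ : (fun n => _) = (fun n => M * (n%:R `^ p / n.+1%:R `^ p) +
  (\sum_(0 <= k < n) w k) / n.+1%:R `^ p)); last first.
  by apply/funext => n; rewrite sw mulrDl mulrA.
rewrite -/M -[X in _ --> X]addr0; apply: cvgD => //.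
rewrite -[X in _ --> X]mulr1; apply: cvgM; first exact: cvg_cst.
exact: natr_powR_ratio_cvg.
Unshelve. all: by end_near. Qed.
End weighted_cesaro.

(** * Convergence *)

(** A tour never uses the diagonal, whose entries are unconstrained. With a single city the closing
    edge would be diagonal, hence [0 < n]. *)
Lemma NN_tour_off_diagonal (R : realType) n (l l' : 'I_n.+1 -> 'I_n.+1 -> R) v :
  (0 < n)%N -> (forall i j, i != j -> l i j = l' i j) -> NN_tour l v ->
  NN_tour l' v /\ tour_length l v = tour_length l' v.
Proof.
move=> n0 ll' [v0 vS vn].
have off k u : u \notin visited v k -> v k != u.
  by apply: contraNneq => <-; apply/imsetP; exists ord_max.
have vis0 k : ord0 \in visited v k.
  by rewrite -v0; apply/imsetP; exists ord0.
split.
  split=> // k kn; have [vk vmin] := vS k kn; split=> // u uU.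
  by rewrite -!ll' ?off//; exact: vmin.
apply: eq_bigr => k _; apply: ll'; have := ltn_ord k; rewrite ltnS leq_eqVlt.
move=> /orP[/eqP ->|kn]; last by apply: off; exact: (vS k kn).1.
have h : (n.-1 < n)%N by rewrite prednK.
by rewrite vn; have := (vS _ h).1; rewrite prednK//; apply: contraNneq => ->.
Qed.

(* The distances are nonnegative only almost surely; their absolute values
   satisfy the same hypotheses. *)
Section absolute_distances.
Context d (T : measurableType d) (R : realType) (P : probability T R) (n : nat)
  (F : probability R R) (L : 'I_n.+1 -> 'I_n.+1 -> {RV P >-> R}).
Hypotheses (F_supp : F `[0%R, +oo[%classic = 1%E) (L_iid : mean_field_distances F L).

Lemma mean_field_abs_distances :
  [/\ forall i j, measurable_fun setT (fun w => `|L i j w|),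
      forall i j w, `|L i j w| = `|L j i w|,
      forall (i j : 'I_n.+1) (A : set R), (i < j)%N -> measurable A ->
        P ((fun w => `|L i j w|) @^-1` A) = F A &
      mutually_independent P [set ij : 'I_n.+1 * 'I_n.+1 | (ij.1 < ij.2)%N]%SET
        (fun ij w => `|L ij.1 ij.2 w|)].
Proof.
have [Lsym Ldist Lind] := L_iid.
have mN (A : set R) : measurable A -> measurable ((fun y : R => `|y|) @^-1` A).
  by move=> mA; rewrite -[X in measurable X]setTI; exact: normr_measurable.
split.
- by move=> i j; apply: measurableT_comp; [exact: normr_measurable|exact: measurable_funPT].
- by move=> i j w; rewrite Lsym.
- move=> i j A ij mA; have := Ldist i j _ ij (mN _ mA).
  rewrite /distribution/= /pushforward => h.
  rewrite (_ : P _ = F ((fun y : R => `|y|) @^-1` A))//.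
  rewrite (density_measure_setI F_supp (mN _ mA)) [RHS](density_measure_setI F_supp)//.
  congr (F _); apply/seteqP; split=> y /=; rewrite in_itv/= andbT => -[h1 y0];
    by split=> //; move: h1; rewrite ger0_norm.
- move=> J B JD mB.
  exact: (Lind J (fun i => (fun y : R => `|y|) @^-1` B i) JD (fun i => mN _ (mB i))).
Qed.

Lemma ae_distances_ge0 :
  {ae P, forall w, forall i j, i != j -> L i j w = `|L i j w|}.
Proof.
have [Lsym Ldist _] := L_iid.
have H (i j : 'I_n.+1) : (i < j)%N -> {ae P, forall w, L i j w = `|L i j w|}.
  move=> ij; exists (L i j @^-1` (~` `[0%R, +oo[%classic)).
  have m0 : measurable (~` `[0%R, +oo[%classic : set R) by exact: measurableC.
  split.
  - by rewrite -[X in measurable X]setTI; exact: measurable_funPT.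
  - by have := Ldist i j _ ij m0; rewrite /distribution/= /pushforward => ->;
    exact: density_measure_neg.
  - move=> w /=; apply: contra_not; rewrite in_itv/= andbT.
    by move=> /ger0_norm ->.
apply: filter_forall => i; apply: filter_forall => j.
have [ij|ji|/ord_inj ij] := ltngtP i j.
- by apply: filterS (H _ _ ij) => w.
- by apply: filterS (H _ _ ji) => w; rewrite !(Lsym i j).
- by apply: aeW => w; rewrite ij eqxx.
Qed.
End absolute_distances.

(** * Consequences of a vanishing mean square error *)

Section convergence_modes.
Context (R : realType) (d : nat -> measure_display)
  (T : forall n, measurableType (d n)) (P : forall n, probability (T n) R)
  (X : forall n, T n -> R) (c : R) (err : nat -> R).
Arguments X : clear implicits.
Hypotheses (mX : forall n, measurable_fun setT (X n))
  (X_err : \forall n \near \oo, (\int[P n]_w ((X n w - c) ^+ 2)%:E <= (err n)%:E)%E)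
  (err0 : err n @[n --> \oo] --> (0 : R)).

Let nD n : nonneg_mfun (fun w : T n => (X n w - c) ^+ 2).
Proof.
split=> [|w]; last by rewrite sqr_ge0.
by apply: measurable_funX; exact: measurable_funB.
Qed.

(** Chebyshev: [e ^+ 2] times the indicator of the event is below the squared error. *)
Lemma sqr_error_cvg_in_probability : cvg_in_probability P X c.
Proof.
move=> e e0; have e20 : 0 < e ^+ 2 by rewrite exprn_gt0.
have mA n : measurable [set w | e <= `|X n w - c|].
  have : measurable_fun setT (fun w : T n => e <= `|X n w - c|).
    apply: measurable_fun_ler => //; apply: measurableT_comp => //.
    exact: measurable_funB.
  by move=> /(_ measurableT [set true]); rewrite setTI; exact.
apply: (@squeeze_cvge _ _ _ _ (fun=> 0%E) _ (fun n => (err n / e ^+ 2)%:E)).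
- near=> n; rewrite measure_ge0/=.
  rewrite EFinM lee_pdivlMr//.
  have Xn : (\int[P n]_w ((X n w - c) ^+ 2)%:E <= (err n)%:E)%E by near: n.
  apply: le_trans Xn.
  have nb : nonneg_mfun (fun w : T n => (e <= `|X n w - c|)%R%:R : R).
    split=> //; have mb : measurable_fun setT (fun b : bool => b%:R : R) by [].
    apply: (measurableT_comp mb); apply: measurable_fun_ler => //.
    by apply: measurableT_comp => //; exact: measurable_funB.
  rewrite -(Ex_bool (P n) (mA n)) muleC -ExZl ?(ltW e20)//.
  apply: le_Ex => //.
    by apply: nonneg_mfunM => //; apply: nonneg_mfun_cst; exact: ltW.
  move=> w; case: (boolP (e <= _)) => h; rewrite ?mulr0 ?sqr_ge0// mulr1.
  by rewrite -[leRHS]real_normK ?num_real// lerXn2r// nnegrE ltW.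
- exact: cvg_cst.
- apply: cvg_EFin; first by near=> n.
  rewrite -[X in _ --> X](mul0r (e ^+ 2)^-1); apply: cvgM => //; exact: cvg_cst.
Unshelve. all: by end_near. Qed.

Lemma sqr_error_cvg_in_L2 : cvg_in_L2 P X c.
Proof.
rewrite /cvg_in_L2.
apply: (@squeeze_cvge _ _ _ _ (fun=> 0%E) _ (fun n => (Num.sqrt (err n))%:E)).
- near=> n; rewrite Lnorm_ge0/=.
  have Xn : (\int[P n]_w ((X n w - c) ^+ 2)%:E <= (err n)%:E)%E by near: n.
  have err_ge0 : 0 <= err n by rewrite -lee_fin (le_trans _ Xn)// Ex_ge0.
  rewrite unlock; under eq_integral => w _.
    rewrite abse_EFin poweR_EFin powR_mulrn// real_normK ?num_real//.
    over.
  rewrite -powR12_sqrt// -poweR_EFin; apply: gt0_ler_poweR => //.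
  - by rewrite in_itv/= leey andbT Ex_ge0.
  - by rewrite in_itv/= lee_fin err_ge0 leey.
- exact: cvg_cst.
- apply: cvg_EFin; first by near=> n.
  rewrite -[X in _ --> X](sqrtr0 R).
  apply: (@continuous_cvg _ _ _ _ _ _ (@Num.sqrt R)) => //.
  exact: sqrt_continuous.
Unshelve. all: by end_near. Qed.

Lemma sqr_error_mean_le (e : R) : 0 < e ->
  \forall n \near \oo, (\int[P n]_w (`|X n w - c|)%:E <= e%:E)%E.
Proof.
move=> e0; have e20 : 0 < e ^+ 2 by rewrite exprn_gt0.
move/cvgrPdist_le : err0 => /(_ _ e20) err0'; near=> n.
have Xn : (\int[P n]_w ((X n w - c) ^+ 2)%:E <= (err n)%:E)%E by near: n.
have hn : `|0 - err n| <= e ^+ 2 by near: n.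
have en : err n <= e ^+ 2.
  by apply: le_trans hn; rewrite sub0r normrN ler_norm.
have nN : nonneg_mfun (fun w : T n => `|X n w - c|).
  by split=> //; apply: measurableT_comp => //; exact: measurable_funB.
have e20' : 0 <= (2 * e)^-1 by rewrite invr_ge0 mulr_ge0// ltW.
have n1 : nonneg_mfun (fun _ : T n => e / 2).
  by apply: nonneg_mfun_cst; rewrite divr_ge0// ltW.
have n2 : nonneg_mfun (fun w : T n => (2 * e)^-1 * (X n w - c) ^+ 2).
  by apply: nonneg_mfunM => //; exact: nonneg_mfun_cst.
(* AM-GM: |y| <= e / 2 + y ^ 2 / (2 e) *)
apply: (le_trans (le_Ex (P n) nN (nonneg_mfunD n1 n2) _)).
  move=> w; have := sqr_ge0 (`|X n w - c| - e).
  rewrite -[(X n w - c) ^+ 2]real_normK ?num_real//; set y := `|_| => hy.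
  have -> : e / 2 + (2 * e)^-1 * y ^+ 2 = (e ^+ 2 + y ^+ 2) / (2 * e).
    by field; rewrite gt_eqF.
  by rewrite ler_pdivlMr ?mulr_gt0//; nra.
rewrite ExD// (ExZl _ e20' (nD n)) integral_cst//= probability_setT mule1.
apply: (@le_trans _ _ ((e / 2)%:E + (2 * e)^-1%:E * (e ^+ 2)%:E)%E).
  apply: leeD => //; apply: lee_wpmul2l; first by rewrite lee_fin.
  by apply: (le_trans Xn); rewrite lee_fin.
rewrite -EFinM -EFinD lee_fin le_eqVlt; apply/orP; left; apply/eqP; field.
by rewrite gt_eqF.
Unshelve. all: by end_near. Qed.
End convergence_modes.

(** Ensures that the limit constant is nonzero, so that one can divide by it. The integral is at
    least its part over [[0, 1]], where the integrand is at least [exp (- 1)]. *)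
Lemma Gamma_1D_gt0 (R : realType) (g : R) : 2^-1 <= g -> 0 < Gamma (1 + g^-1).
Proof.
move=> g2; have := @stretched_exponential_integral R 1 g ltr01 g2.
rewrite powR1 mul1r => GE; rewrite -lte_fin -GE.
apply: (@lt_le_trans _ _
  (\int[@lebesgue_measure R]_(t in `[0%R, 1%R]) (expR (- 1))%:E)%E).
  rewrite integral_cst//= lebesgue_measure_itv/= lte_fin ltr01 oppr0 adde0 mule1.
  by rewrite lte_fin expR_gt0.
have mE : measurable_fun (`[0%R, +oo[%classic : set R)
    (fun t : R => (expR (- (1 * t `^ g)))%:E).
  apply: measurable_funTS; apply/measurable_EFinP.
  apply: (measurableT_comp (@measurable_expR R)).
  by apply: measurableT_comp => //; apply: measurable_funM.
apply: (@le_trans _ _ (\int[@lebesgue_measure R]_(t in `[0%R, 1%R])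
    (expR (- (1 * t `^ g)))%:E)%E); last first.
  by apply: ge0_subset_integral => //; apply: subset_itvl; rewrite bnd_simp.
apply: ge0_le_integral => //.
  by apply: measurable_funS mE => //; apply: subset_itvl; rewrite bnd_simp.
move=> t; rewrite /= in_itv/= => /andP[t0 t1].
rewrite lee_fin ler_expR lerN2 mul1r -[leRHS](_ : 1 `^ g = 1); last by rewrite powR1.
by apply: ge0_ler_powR; rewrite ?nnegrE//; apply: le_trans g2; rewrite invr_ge0.
Qed.

Lemma integral_near_const d (T : measurableType d) (R : realType)
    (P : probability T R) (X : T -> R) (c e : R) :
  measurable_fun setT X -> (\int[P]_w (`|X w - c|)%:E <= e%:E)%E ->
  P.-integrable setT (fun w => (X w)%:E) /\
  (`|\int[P]_w (X w)%:E - c%:E| <= e%:E)%E.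
Proof.
move=> mX hX; have mD : measurable_fun setT (fun w => (X w - c)%:E).
  by apply/measurable_EFinP; exact: measurable_funB.
have iD : P.-integrable setT (fun w => (X w - c)%:E).
  by apply/integrableP; split=> //; apply: le_lt_trans hX _; rewrite ltry.
have ic : P.-integrable setT (fun=> c%:E).
  exact: finite_measure_integrable_cst.
have XE : (fun w => (X w)%:E) = (fun w => (X w - c)%:E + c%:E)%E.
  by apply/funext => w; rewrite -EFinD subrK.
split; first by rewrite XE; exact: integrableD.
have -> : (\int[P]_w (X w)%:E = \int[P]_w (X w - c)%:E + c%:E)%E.
  rewrite XE.
  rewrite integralD//; congr (_ + _)%E.
  by rewrite integral_cst//= probability_setT mule1.
rewrite addeK//; apply: le_trans hX.
exact: le_abse_integral.
Qed.

Theorem theorem2p3 (R : realType) (F : probability R R) (f : R -> R)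
    (C alpha : R)
    (d : nat -> measure_display) (Omega : forall n, measurableType (d n))
    (P : forall n, probability (Omega n) R)
    (L : forall n, 'I_n.+1 -> 'I_n.+1 -> {RV (P n) >-> R})
    (v : forall n, Omega n -> nat -> 'I_n.+1)
    (T : forall n, {RV (P n) >-> R})
    (F_supp : F `[0, +oo[%classic = 1%E)
    (F_mean : F.-integrable [set: R] (fun t => t%:E))
    (F_var : ('V_F[fun t : R => t] < +oo)%E)
    (F_density : is_density F f)
    (C_gt0 : 0 < C)
    (alpha_gt0 : 0 < alpha)
    (alpha_lt1 : alpha < 1)
    (f_at0 : f t / t `^ alpha @[t --> 0^'+] --> C)
    (L_iid : forall n, mean_field_distances F (L n))
    (v_NN : forall n w, NN_tour (fun i j => L n i j w) (v n w))
    (T_def : forall n w, T n w = tour_length (fun i j => L n i j w) (v n w)) :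
  let K := NN_constant C alpha in
  let b := fun n : nat => n.+1%:R `^ (1 - (1 + alpha)^-1) in
  [/\ cvg_in_probability P (fun n w => T n w / b n) K,
      asymptotically_equal (fun n => 'E_(P n)[T n]%E) (fun n => K * b n) &
      cvg_in_L2 P (fun n w => T n w / b n) K].
Proof.
move=> K b.
pose g := 1 + alpha; pose be := g^-1.
have g1 : 1 < g by rewrite ltrDl.
have g0 : 0 < g by exact: lt_trans g1.
have be1 : be < 1 by rewrite invf_lt1.
pose a (k m : nat) : R := fine (min_moment F k m).
have aE k m : (0 < k <= 2)%N -> min_moment F k m.+1 = (a k m.+1)%:E.
  by move=> k02; rewrite fineK//; exact: min_moment_fin.
pose S n := \sum_(1 <= k < n.+1) a 1 k; pose Q n := \sum_(1 <= k < n.+1) a 2 k.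
have b0 n : 0 < b n by exact: powR_gt0.
have p0 : 0 < 1 - be by rewrite subr_gt0.
(* The constant for one minimum divided by [1 - be], the form in which summation produces it. *)
have KE : K = (C / g) `^ (- be) * Gamma (1 + be) / (1 - be).
  have -> : 1 - be = alpha / g.
    apply: (mulIf (lt0r_neq0 g0)).
    by rewrite mulrBl mulVf ?divfK ?gt_eqF// mul1r /g addrC addKr.
  rewrite /K /NN_constant -/g -/be powRN -powRV_ge0 ?divr_ge0 ?(ltW C_gt0) ?(ltW g0)//.
  by rewrite !invf_div mulrAC.
have Kgt0 : 0 < K.
  by rewrite KE !mulr_gt0 ?powR_gt0 ?invr_gt0 ?divr_gt0 ?Gamma_1D_gt0//; lra.
have K0 := ltW Kgt0.
have Scvg : S n / b n @[n --> \oo] --> K.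
  rewrite KE; apply: weighted_cesaro => //; rewrite subKr.
  exact: (mom1_cvg F_supp F_mean F_var F_density C_gt0 alpha_gt0 f_at0).
(* The same summation lemma with exponent [2 - 2 * be], that of [b n ^+ 2], and limit [0]. *)
have Qcvg : Q n / b n ^+ 2 @[n --> \oo] --> (0 : R).
  have bE n : b n ^+ 2 = n.+1%:R `^ (2 - 2 * be).
    by rewrite /b -powR_mulrn ?powR_ge0// -powRrM; congr (_ `^ _); rewrite -/g -/be; ring.
  rewrite (_ : (fun n => _) = (fun n => Q n / n.+1%:R `^ (2 - 2 * be))); last first.
    by apply/funext => n; rewrite bE.
  rewrite -[X in _ --> X](mul0r (2 - 2 * be)^-1); apply: weighted_cesaro; first lra.
  have -> : 1 - (2 - 2 * be) = 2 * be - 1 by ring.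
  exact: (mom2_cvg F_supp F_mean F_var F_density C_gt0 alpha_gt0 f_at0).
have bV : (b n)^-1 @[n --> \oo] --> (0 : R) by exact: natr_powRN_cvg0.
(* After division by [b n ^+ 2]: fluctuation of the walk, its squared bias around [K * b n], and the
   closing edge. *)
pose err n := 2 *
  (Q n / b n ^+ 2 + (S n / b n - K) ^+ 2 + 2 * a 2 1 * ((b n)^-1 * (b n)^-1)).
have err0 : err n @[n --> \oo] --> (0 : R).
  rewrite -[X in _ --> X](mulr0 2); apply: cvgM; first exact: cvg_cst.
  rewrite -[X in _ --> X](addr0 0); apply: cvgD; last first.
    rewrite -[X in _ --> X](mulr0 (2 * a 2 1)); apply: cvgM; first exact: cvg_cst.
    by rewrite -[X in _ --> X](mulr0 0); apply: cvgM.
  rewrite -[X in _ --> X](addr0 0); apply: cvgD => //.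
  rewrite -[X in _ --> X](mulr0 0) -{1 2}(subrr K); apply: cvgM.
    by apply: cvgB => //; exact: cvg_cst.
  by apply: cvgB => //; exact: cvg_cst.
have Xerr : \forall n \near \oo,
    (\int[P n]_w ((T n w / b n - K) ^+ 2)%:E <= (err n)%:E)%E.
  near=> n; have n1 : (1 < n)%N by near: n; exact: nbhs_infty_gt.
  have n0 : (0 < n)%N by exact: ltn_trans n1.
  have [ml lC lF li] := mean_field_abs_distances F_supp (L_iid n).
  have vT : {ae P n, forall w, NN_tour (fun i j => `|L n i j w|) (v n w) /\
      T n w = tour_length (fun i j => `|L n i j w|) (v n w)}.
    apply: filterS (ae_distances_ge0 F_supp (L_iid n)) => w hw.
    by rewrite T_def; exact: (NN_tour_off_diagonal n0 hw (v_NN n w)).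
  have := @Ex_tour_length_error _ _ _ (P n) n F (fun i j w => `|L n i j w|) ml
    (fun i j w => normr_ge0 _) lC lF li (density_atomless F_density)
    (a 1) (a 2) (fun m => aE 1 m isT) (fun m => aE 2 m isT) (v n) (T n)
    (K * b n) n1 (mulr_ge0 K0 (ltW (b0 n))) (measurable_funPT _) vT.
  rewrite -/(S n) -/(Q n) => hE.
  have bN : b n != 0 by rewrite gt_eqF.
  have b20 : 0 <= (b n ^+ 2)^-1 by rewrite invr_ge0 sqr_ge0.
  have nT : nonneg_mfun (fun w => (T n w - K * b n) ^+ 2).
    by split=> [|w]; [apply/measurable_funX/measurable_funB|rewrite sqr_ge0].
  rewrite (_ : (\int[P n]_w _)%E =
    (((b n ^+ 2)^-1)%:E * \int[P n]_w ((T n w - K * b n) ^+ 2)%:E)%E); last first.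
    rewrite -ExZl//; apply: eq_integral => w _; congr (_%:E).
    by field.
  apply: (le_trans (lee_wpmul2l _ hE)); first by rewrite lee_fin.
  rewrite -EFinM lee_fin le_eqVlt; apply/orP; left; apply/eqP; rewrite /err.
  by field.
have mX n : measurable_fun setT (fun w => T n w / b n) by exact: measurable_funM.
(* The expectation is an extended real; the witness [i] records that it is finite, so that the
   quotient reduces to one of real numbers. *)
have ET e : 0 < e -> \forall n \near \oo,
    exists2 i, i%:E = ('E_(P n)[T n])%E & `|i / (K * b n) - 1| <= e.
  move=> e0; have eK0 : 0 < e * K by exact: mulr_gt0.
  have Xe := @sqr_error_mean_le _ _ _ _ (fun n w => T n w / b n) K err mX Xerr err0 _ eK0.
  near=> n; have hn : (\int[P n]_w (`|T n w / b n - K|)%:E <= (e * K)%:E)%E by near: n.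
  have [iX] := integral_near_const (mX n) hn; set I := (\int[P n]_w _)%E => hI.
  have Ifin : I \is a fin_num by move: hI; case: I => [|//|//].
  exists (b n * fine I).
    rewrite EFinM fineK// expectation_def /I -integralZl//.
    by apply: eq_integral => w _; rewrite -EFinM mulrC divfK// gt_eqF.
  have bN : b n != 0 by rewrite gt_eqF.
  have KN : K != 0 by rewrite gt_eqF.
  move: hI; rewrite -(fineK Ifin) -EFinB lee_fin => hI.
  have -> : b n * fine I / (K * b n) - 1 = (fine I - K) / K by field; rewrite KN bN.
  by rewrite normrM [`|K^-1|]gtr0_norm ?invr_gt0// ler_pdivrMr.
split.
- exact: (@sqr_error_cvg_in_probability _ _ _ _ (fun n w => T n w / b n) K err).
- apply: cvg_EFin.
    near=> n.
    have [i <- _] : exists2 i, i%:E = ('E_(P n)[T n])%E & `|i / (K * b n) - 1| <= 1.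
      by near: n; exact: ET.
    by rewrite inver mulf_eq0 !gt_eqF//=.
  apply/cvgrPdist_le => e e0; near=> n.
  have [i iE ie] : exists2 i, i%:E = ('E_(P n)[T n])%E & `|i / (K * b n) - 1| <= e.
    by near: n; exact: ET.
  by rewrite /= -iE inver mulf_eq0 !gt_eqF//= distrC.
- exact: (@sqr_error_cvg_in_L2 _ _ _ _ (fun n w => T n w / b n) K err).
Unshelve. all: by end_near. Qed.
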